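(* Let $M$ be a pseudo-umbilical submanifold of $\mathbb{S}^n$, of dimension $m$, whose mean curvature $H$ is parallel ($\nabla^N H=0$) and of nonzero constant norm. Then: 1. $M$ is properly biharmonic of index $m(1-|H|^2)$ in $\mathbb{S}^n$; 2. $M$ is harmonic in $\mathbb{S}\bigl(\tfrac{1}{\sqrt{1+|H|^2}}\bigr)$, the hypersphere of $\mathbb{S}^n$ of radius $\tfrac{1}{\sqrt{1+|H|^2}}$.
   Context: $\mathbb{S}^n\subset\mathbb{R}^{n+1}$ is the unit sphere with its canonical metric; submanifolds carry the induced metric $g$. For $a\in\,]0,1]$ and $b=\sqrt{1-a^2}$, the hypersphere of radius $a$ of $\mathbb{S}^n$ is $\mathbb{S}(a)=\mathbb{S}^{n-1}(a)=\{(x,b)\in\mathbb{R}^{n+1}: x\in\mathbb{R}^n,\ |x|=a\}\subset\mathbb{S}^n$. $B$ is the second fundamental form of $M$ in $\mathbb{S}^n$, $A$ the Weingarten operator ($g(A_\xi X,Y)=\langle B(X,Y),\xi\rangle$ for $\xi$ normal and $X,Y$ tangent to $M$), $H=\frac1m\operatorname{tr}B$ the mean curvature, and $\nabla^N$ the connection on the normal bundle of $M$ in $\mathbb{S}^n$. $M$ is pseudo-umbilical if $A_H=|H|^2\,\mathrm{Id}_{TM}$. A submanifold is harmonic in an ambient manifold if its inclusion is a harmonic map, i.e. if its mean curvature there vanishes. With $i:M\to\mathbb{S}^n$ the inclusion and $\Delta=-\operatorname{tr}\nabla^2$ the (nonnegative) rough Laplacian on sections of $i^*T\mathbb{S}^n$,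 $M$ is biharmonic of index $k\in\mathbb{R}$ in $\mathbb{S}^n$ if $(\Delta-m+k)H=0$, and properly so if moreover the inclusion is not harmonic.
   Formalization: In item 2, M is assumed connected (two disjoint equal small circles about different axes of S^2 lie in no common hypersphere), and the hypersphere of radius 1/sqrt(1+|H|^2) is taken up to an isometry of S^n, since a rotated M leaves the fixed slice S(a). *)

(* Defs.v *)
From HB Require Import structures.
From mathcomp Require Import all_boot all_order all_algebra.
From mathcomp Require Import all_classical all_reals all_analysis.

Set Implicit Arguments.
Unset Strict Implicit.
Unset Printing Implicit Defensive.

Import Order.TTheory GRing.Theory Num.Theory.
Import numFieldNormedType.Exports.

Local Open Scope classical_set_scope.
Local Open Scope ring_scope.

(* Geometry of submanifolds of a submanifold [N] of Euclidean space [R^d].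
   Every bundle that occurs (TM, TN, the normal bundle, i^*TN) is a subbundle of
   the trivial bundle with fibre R^d, so all sections are functions M -> R^d,
   and all connections are orthogonal projections of the flat derivative.
   Objects whose textbook definition involves an auxiliary choice (a chart, an
   extension of a vector to a field, an orthonormal basis) are introduced as
   [get] of the set of values obtained over all choices. *)

Section Euclidean.
Variables (R : realType) (d : nat).
Implicit Types (u v : 'rV[R]_d) (V : set 'rV[R]_d).

Definition dot u v : R := \sum_(k < d) u 0 k * v 0 k.

(* The library norm `|v| on matrices is the sup norm. *)
Definition enorm v : R := Num.sqrt (dot v v).

(* orthogonal projection of v on the linear subspace V *)
Definition proj V v : 'rV[R]_d :=
  get [set t | V t /\ forall s, V s -> dot (v - t) s = 0].

(* tangent space at x of a submanifold N of R^d, as the set of velocities *)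
Definition tangent_space (N : set 'rV[R]_d) (x : 'rV[R]_d) : set 'rV[R]_d :=
  [set v | exists gamma : R -> 'rV[R]_d,
     [/\ gamma 0 = x, forall t, N (gamma t) & is_derive (0 : R) 1 gamma v]].

End Euclidean.

Section Smooth.
Variables (R : realType) (m d : nat).

Fixpoint Ck (k : nat) (U : set 'rV[R]_m) (f : 'rV[R]_m -> 'rV[R]_d) : Prop :=
  if k is k'.+1 then
    (forall u, U u -> differentiable f u) /\ forall w, Ck k' U ('D_w f)
  else forall u, U u -> {for u, continuous f}.

(* meant for U open *)
Definition smooth (U : set 'rV[R]_m) (f : 'rV[R]_m -> 'rV[R]_d) : Prop :=
  forall k, Ck k U f.

End Smooth.

Section Submanifold.
Variables (R : realType) (m d : nat) (M : topologicalType) (i : M -> 'rV[R]_d).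

(* The charts (written as parametrizations) of the smooth structure of M:
   homeomorphisms phi from an open set of R^m onto an open set of M such that
   i \o phi is a smooth immersion. Changes of charts are then automatically
   smooth, by the inverse function theorem. *)
Definition local_param (U : set 'rV[R]_m) (phi : 'rV[R]_m -> M) : Prop :=
  [/\ open U,
      forall u v, U u -> U v -> phi u = phi v -> u = v,
      forall u, U u -> {for u, continuous phi},
      forall V, open V -> V `<=` U -> open (phi @` V) &
      smooth U (i \o phi) /\ forall u, U u -> injective ('d (i \o phi) u)].

(* M, with inclusion i, is an m-dimensional submanifold of R^d. M carries its
   own topology; embedded submanifolds are the case of the induced topology. *)
Definition submanifold : Prop :=
  [/\ hausdorff_space M, @second_countable M, injective i &
      forall p, exists U phi, local_param U phi /\ (phi @` U) p].

Definition TM (p : M) : set 'rV[R]_d :=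
  [set X | exists U phi u w,
     [/\ local_param U phi, U u, phi u = p & 'D_w (i \o phi) u = X]].

(* derivative at p of F : M -> R^d in the direction of X \in TM p *)
Definition dder (F : M -> 'rV[R]_d) (p : M) (X : 'rV[R]_d) : 'rV[R]_d :=
  get [set Z | exists U phi u w,
    [/\ local_param U phi, U u, phi u = p, 'D_w (i \o phi) u = X &
        Z = 'D_w (F \o phi) u]].

Definition smooth_on (O : set M) (F : M -> 'rV[R]_d) : Prop :=
  forall U phi, local_param U phi -> smooth (U `&` phi @^-1` O) (F \o phi).

(* Yf is a smooth tangent vector field near p with value Y at p *)
Definition extension (p : M) (Y : 'rV[R]_d) (Yf : M -> 'rV[R]_d) : Prop :=
  Yf p = Y /\
  exists O : set M, [/\ open O, O p, smooth_on O Yf & forall q, O q -> TM q (Yf q)].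

(* trace with respect to the induced metric on TM p *)
Definition trace (p : M) (b : 'rV[R]_d -> 'rV[R]_d -> 'rV[R]_d) : 'rV[R]_d :=
  get [set t | exists e : 'I_m -> 'rV[R]_d,
    [/\ forall j, TM p (e j), forall j k, dot (e j) (e k) = (j == k)%:R &
        t = \sum_j b (e j) (e j)]].

(* Levi-Civita connection of M; the vector argument comes last *)
Definition nablaM (Y : M -> 'rV[R]_d) (p : M) (X : 'rV[R]_d) : 'rV[R]_d :=
  proj (TM p) (dder Y p X).

(* N is the ambient submanifold of R^d, with i(M) contained in N *)
Variable N : set 'rV[R]_d.

(* pull-back to i^*TN of the Levi-Civita connection of N *)
Definition nablaN (V : M -> 'rV[R]_d) (p : M) (X : 'rV[R]_d) : 'rV[R]_d :=
  proj (tangent_space N (i p)) (dder V p X).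

(* connection on the normal bundle of M in N *)
Definition nabla_normal (xi : M -> 'rV[R]_d) (p : M) (X : 'rV[R]_d) : 'rV[R]_d :=
  nablaN xi p X - proj (TM p) (nablaN xi p X).

(* second fundamental form of M in N *)
Definition sff (p : M) (X Y : 'rV[R]_d) : 'rV[R]_d :=
  get [set Z | exists Yf, extension p Y Yf /\ Z = nablaN Yf p X - nablaM Yf p X].

Definition weingarten (p : M) (xi X : 'rV[R]_d) : 'rV[R]_d :=
  get [set Z | TM p Z /\ forall Y, TM p Y -> dot Z Y = dot (sff p X Y) xi].

Definition mean_curvature (p : M) : 'rV[R]_d := m%:R^-1 *: trace p (sff p).

Definition pseudo_umbilical : Prop :=
  forall p X, TM p X ->
    weingarten p (mean_curvature p) X = enorm (mean_curvature p) ^+ 2 *: X.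

Definition parallel_mean_curvature : Prop :=
  forall p X, TM p X -> nabla_normal mean_curvature p X = 0.

Definition harmonic_in : Prop :=
  (forall p, N (i p)) /\ forall p, mean_curvature p = 0.

(* second covariant derivative nabla_X nabla_Y V - nabla_(nabla_X Y) V of a
   section V of i^*TN *)
Definition hessian (V : M -> 'rV[R]_d) (p : M) (X Y : 'rV[R]_d) : 'rV[R]_d :=
  get [set Z | exists Yf, extension p Y Yf /\
    Z = nablaN (fun q => nablaN V q (Yf q)) p X - nablaN V p (nablaM Yf p X)].

Definition rough_laplacian (V : M -> 'rV[R]_d) (p : M) : 'rV[R]_d :=
  - trace p (hessian V p).

Definition biharmonic_of_index (k : R) : Prop :=
  forall p, rough_laplacian mean_curvature p
            - m%:R *: mean_curvature p + k *: mean_curvature p = 0.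

Definition properly_biharmonic_of_index (k : R) : Prop :=
  biharmonic_of_index k /\ ~ harmonic_in.

End Submanifold.

Section Spheres.
Variables (R : realType) (n : nat).

(* the unit sphere S^n of R^(n+1) *)
Definition sphere : set 'rV[R]_(n + 1) := [set x | enorm x = 1].

(* S(a) = {(x, b) : |x| = a} with b = sqrt (1 - a^2) *)
Definition hypersphere (a : R) : set 'rV[R]_(n + 1) :=
  [set row_mx x (Num.sqrt (1 - a ^+ 2))%:M | x in [set x : 'rV[R]_n | enorm x = a]].

(* isometries of S^n are the restrictions of the x |-> x *m Q, Q orthogonal *)
Definition orthogonal_mx (Q : 'M[R]_(n + 1)) : Prop := Q *m Q^T = 1%:M.

End Spheres.

(* Main.v *)
Require Import Defs.
From mathcomp Require Import all_boot all_order all_algebra.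
From mathcomp Require Import all_classical all_reals all_analysis.
From mathcomp Require Import ring lra.

Import Order.TTheory GRing.Theory Num.Theory.
Import numFieldNormedType.Exports.

Local Open Scope classical_set_scope.
Local Open Scope ring_scope.

Set Implicit Arguments.
Unset Strict Implicit.
Unset Printing Implicit Defensive.

(** The Euclidean derivative of H along M is computed completely by the
    hypotheses. Write i for the position vector of M. If X is tangent to M,
    then the derivative D_X H has no component along i, because <H, i> = 0 and
    <H, X> = 0; no other component normal to M, because H is parallel; and its
    tangent part is - A_H X = - |H|^2 X, because M is pseudo-umbilical. Hence
    D_X H = - h^2 X with h = |H| (dder_mean_curvature).

    It follows that nabla H is - h^2 times the inclusion TM -> i^*TS^n, so that
    the Hessian of H is - h^2 times the second fundamental form, and taking the
    trace, Delta H = m h^2 H (rough_laplacian_mean_curvature). This is the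
    biharmonic equation of index m (1 - h^2), and H <> 0 makes it proper.

    It also follows that H + h^2 i has zero derivative, so it is a constant
    vector C on a connected M (connected_constant). Since <i, C> = h^2 and
    |C|^2 = h^2 (1 + h^2), M lies in the hypersphere of points of S^n whose
    scalar product with C / |C| is h / sqrt (1 + h^2); its radius is
    1 / sqrt (1 + h^2). The mean curvature of M in that hypersphere is the
    projection of H = C - h^2 i to the tangent space of the hypersphere
    (mean_curvature_small_sphere), and C and i are both normal to it.

    The geometric objects depend on choices of charts, extensions and frames,
    and have to be shown independent of them. One device serves throughout: the
    orthogonal projection T_q on the tangent space of M at q, as a matrix. In a
    chart it is a rational function of the first derivatives of the immersion
    (smooth_proj), so q |-> Y T_q is a smooth tangent field which extends any
    tangent vector Y (extension_proj), and H is an explicit differentiable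
    function of q obtained by contracting the derivative of T with T itself
    (trace_sff, mdiff_mean_curvature). Changes of charts enter through their
    differentials (transition). *)

(** * Euclidean linear algebra *)

Section InnerProduct.
Variables (R : realType) (d : nat).
Implicit Types (u v w : 'rV[R]_d) (V : set 'rV[R]_d).

Lemma dotE u v : dot u v = (u *m v^T) 0 0.
Proof. by rewrite mxE; apply: eq_bigr => k _; rewrite mxE. Qed.

Lemma dotC u v : dot u v = dot v u.
Proof. by apply: eq_bigr => k _; rewrite mulrC. Qed.

Lemma dotDl u v w : dot (u + v) w = dot u w + dot v w.
Proof. by rewrite !dotE mulmxDl mxE. Qed.

Lemma dotZl (a : R) u v : dot (a *: u) v = a * dot u v.
Proof. by rewrite !dotE -scalemxAl mxE. Qed.

Lemma dotNl u v : dot (- u) v = - dot u v.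
Proof. by rewrite -scaleN1r dotZl mulN1r. Qed.

Lemma dotBl u v w : dot (u - v) w = dot u w - dot v w.
Proof. by rewrite dotDl dotNl. Qed.

Lemma dot0l v : dot 0 v = 0.
Proof. by rewrite -(scale0r (0 : 'rV_d)) dotZl mul0r. Qed.

Lemma dotDr u v w : dot u (v + w) = dot u v + dot u w.
Proof. by rewrite dotC dotDl !(dotC u). Qed.

Lemma dotZr (a : R) u v : dot u (a *: v) = a * dot u v.
Proof. by rewrite dotC dotZl dotC. Qed.

Lemma dotBr u v w : dot u (v - w) = dot u v - dot u w.
Proof. by rewrite dotC dotBl !(dotC u). Qed.

Lemma dot0r v : dot v 0 = 0.
Proof. by rewrite dotC dot0l. Qed.

Lemma dot_ge0 v : 0 <= dot v v.
Proof. by apply: sumr_ge0 => k _; rewrite -expr2 sqr_ge0. Qed.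

Lemma dot_eq0 v : dot v v = 0 -> v = 0.
Proof.
move=> /eqP; rewrite psumr_eq0 => [/allP v0|k _]; last by rewrite -expr2 sqr_ge0.
apply/rowP => k; rewrite mxE; apply/eqP.
by have := v0 k (mem_index_enum k); rewrite /= -expr2 sqrf_eq0.
Qed.

Lemma enorm_sqr v : enorm v ^+ 2 = dot v v.
Proof. by rewrite sqr_sqrtr // dot_ge0. Qed.

Lemma enormP (r : R) v : 0 <= r -> enorm v = r <-> dot v v = r ^+ 2.
Proof.
move=> r0; split=> [<-|vr]; first by rewrite enorm_sqr.
by rewrite /enorm vr sqrtr_sqr ger0_norm.
Qed.

Lemma projP V v t :
  (forall a b, V a -> V b -> V (a - b)) ->
  V t -> (forall s, V s -> dot (v - t) s = 0) -> Defs.proj V v = t.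
Proof.
move=> VB Vt vt; apply: get_unique => // s [Vs vs].
apply/subr0_eq/dot_eq0.
have Vst := VB _ _ Vs Vt.
by rewrite -[X in dot X _](subrKA v) addrC -opprB dotDl dotNl vs // vt // oppr0 addr0.
Qed.

End InnerProduct.

Section RowSpace.
Variables (R : realType) (m d : nat).
Implicit Types (J E : 'M[R]_(m, d)).

Lemma dot_mulmx k (u : 'rV[R]_k) (A : 'M[R]_(k, d)) (v : 'rV[R]_d) :
  dot (u *m A) v = dot u (v *m A^T).
Proof. by rewrite !dotE trmx_mul trmxK mulmxA. Qed.

(** A vector in the kernel of the Gram matrix has zero length in the row
    space. *)
Lemma gram_unit J : row_free J -> J *m J^T \in unitmx.
Proof.
move=> Jfree; rewrite -row_free_unit -kermx_eq0; apply/eqP/row_matrixP => k.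
rewrite row0; set w := row k _.
have wG : w *m (J *m J^T) = 0 by apply/sub_kermxP; rewrite row_sub.
have wJ : w *m J = 0.
  by apply: dot_eq0; rewrite dot_mulmx -mulmxA wG dot0r.
by apply: (row_free_inj Jfree); rewrite wJ mul0mx.
Qed.

(** Right multiplication by this matrix is left inverse to right
    multiplication by J. *)
Definition rowcoord J : 'M[R]_(d, m) := J^T *m invmx (J *m J^T).

Lemma rowcoordK J (w : 'rV[R]_m) : row_free J -> w *m J *m rowcoord J = w.
Proof. by move=> /gram_unit ?; rewrite /rowcoord !mulmxA -!(mulmxA w) mulmxV ?mulmx1. Qed.

Lemma rowproj_dot J (v : 'rV[R]_d) (w : 'rV[R]_m) : row_free J ->
  dot (v - v *m rowcoord J *m J) (w *m J) = 0.
Proof.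
move=> /gram_unit JJ; rewrite dotC dot_mulmx mulmxBl.
by rewrite /rowcoord -!mulmxA mulVmx // mulmx1 subrr dot0r.
Qed.

(** Gram-Schmidt: as long as there are fewer than m orthonormal vectors, some
    row of J is outside their span, and its component orthogonal to them can be
    normalized. *)
Lemma orthonormal_rows J : row_free J ->
  exists E, E *m E^T = 1%:M /\ (E <= J)%MS.
Proof.
move=> /eqP Jrk; pose Q k := exists E : 'M[R]_(k, d), E *m E^T = 1%:M /\ (E <= J)%MS.
suff: forall k, (k <= m)%N -> Q k by exact.
elim=> [_|k IHk km].
  by exists 0; split; [apply/matrixP; case|rewrite sub0mx].
have [E [EE EJ]] := IHk (ltnW km).
have /row_subPn[r rE] : ~~ (J <= E)%MS.
  apply/negP => /mxrankS; rewrite Jrk => mE.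
  by have := leq_trans km (leq_trans mE (rank_leq_row E)); rewrite ltnn.
set v := row r J - row r J *m E^T *m E.
have v0 : dot v v != 0.
  apply: contraNneq rE => /dot_eq0/subr0_eq ->; exact: submxMl.
have vE : v *m E^T = 0.
  by rewrite mulmxBl -!mulmxA EE mulmx1 subrr.
have v_gt0 : 0 < dot v v by rewrite lt_def v0 dot_ge0.
pose a := (Num.sqrt (dot v v))^-1.
have aa : a ^+ 2 * dot v v = 1 by rewrite exprVn sqr_sqrtr ?dot_ge0 // mulVf.
have onb : col_mx (a *: v) E *m (col_mx (a *: v) E)^T = 1%:M.
  rewrite tr_col_mx mul_col_row EE [(a *: v)^T]linearZ /= -!scalemxAl -!scalemxAr.
  rewrite vE -[E *m v^T]trmxK trmx_mul trmxK vE trmx0 !scaler0.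
  rewrite (@scalar_mx_block _ 1 k); congr block_mx.
  apply/matrixP => i j; rewrite !ord1 [LHS]mxE [X in _ * X]mxE -dotE.
  by rewrite mulrA -expr2 aa mxE.
have sub : (col_mx (a *: v) E <= J)%MS.
  rewrite col_mx_sub EJ andbT scalemx_sub // addmx_sub ?row_sub //.
  by rewrite -scaleN1r scalemx_sub // (submx_trans (submxMl _ _)).
by exists (col_mx (a *: v) E).
Qed.

End RowSpace.

(** Householder's reflection in the hyperplane orthogonal to e - c. *)
Lemma reflection_exists (R : realType) (d : nat) (e c : 'rV[R]_d) :
  dot e e = 1 -> dot c c = 1 ->
  exists Q : 'M[R]_d, [/\ Q *m Q^T = 1%:M, Q^T = Q & e *m Q = c].
Proof.
move=> ee cc; have [<-|ec] := eqVneq e c.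
  by exists 1%:M; rewrite trmx1 !mulmx1.
move vE: (e - c) => v.
have vv0 : dot v v != 0.
  by rewrite -vE; apply: contraNneq ec => /dot_eq0/subr0_eq ->.
set s := 2 / dot v v.
have QT : (1%:M - s *: (v^T *m v))^T = 1%:M - s *: (v^T *m v).
  by rewrite linearB linearZ /= trmx1 trmx_mul trmxK.
have vvE : v *m v^T = (dot v v)%:M.
  by apply/matrixP => i j; rewrite !ord1 dotE [RHS]mxE.
exists (1%:M - s *: (v^T *m v)); rewrite QT; split => //.
- have SS : v^T *m v *m (v^T *m v) = dot v v *: (v^T *m v).
    by rewrite -mulmxA (mulmxA v) vvE mul_scalar_mx -scalemxAr.
  rewrite mulmxBl mul1mx mulmxBr mulmx1 -scalemxAl -scalemxAr SS !scalerA.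
  have -> : s * s * dot v v = s + s by rewrite /s; field.
  by rewrite scalerDl opprB addrK subrK.
- rewrite mulmxBr mulmx1 -scalemxAr mulmxA.
  have -> : e *m v^T = (dot e v)%:M by apply/matrixP => i j; rewrite !ord1 dotE [RHS]mxE.
  rewrite mul_scalar_mx scalerA.
  have -> : s * dot e v = 1.
    have vvE2 : dot v v = 2 * dot e v.
      by rewrite -vE !dotBl !dotBr ee cc (dotC c); ring.
    by rewrite /s vvE2; field; move: vv0; rewrite vvE2; apply: contraNneq => ->; rewrite mulr0.
  by rewrite scale1r -vE opprB addrC subrK.
Qed.

(** * Differential calculus *)

Section Calculus.
Variable R : realType.

Section Differentials.
Variables V W : normedModType R.
Implicit Types f g : V -> W.

Lemma is_diffP f (df : {linear V -> W}) x : continuous df ->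
  (forall eps : R, 0 < eps ->
     \forall h \near (0 : V), `|f (h + x) - f x - df h| <= eps * `|h|) ->
  differentiable f x /\ 'd f x = df :> (V -> W).
Proof.
move=> dfc H.
have E : f \o shift x = cst (f x) + df +o_ 0 id.
  apply/eqaddoP => eps eps0.
  apply: filterS (H _ eps0) => h.
  by rewrite /= !fctE /= opprD addrA.
have D := diff_unique dfc E.
by split=> //; apply/diff_locallyP; rewrite D.
Qed.

Lemma diff_near f x : differentiable f x -> forall eps : R, 0 < eps ->
  \forall h \near (0 : V), `|f (h + x) - f x - 'd f x h| <= eps * `|h|.
Proof.
move=> /diff_locallyP[_ /eqaddoP E] eps eps0.
apply: filterS (E _ eps0) => h.
by rewrite /= !fctE /= opprD addrA.
Qed.

Lemma near_eq_differentiable f g x :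
  (\forall y \near x, f y = g y) -> differentiable f x -> differentiable g x.
Proof.
move=> fg fx.
suff [] : differentiable g x /\ 'd g x = 'd f x :> (V -> W) by [].
apply: is_diffP; first exact: diff_continuous.
move=> eps eps0; have gx := nbhs_singleton fg.
have fg0 : \forall h \near (0 : V), f (h + x) = g (h + x).
  by move: fg; rewrite (near_shift 0) /=; apply: filterS => h /=; rewrite subr0.
by apply: filterS2 fg0 (diff_near fx eps0) => h -> ; rewrite gx.
Qed.

End Differentials.

Section Rows.
Variable V : normedModType R.

Lemma differentiable_mulmxr m d (A : 'M[R]_(m, d)) x :
  differentiable (fun v : 'rV[R]_m => v *m A) x.
Proof.
rewrite (_ : (fun v => _) = \sum_(k < m) (fun v : 'rV[R]_m => v 0 k *: row k A)).
  by apply: differentiable_sum => k; apply/differentiableZl/differentiable_coord.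
by apply/funext => v; rewrite mulmx_sum_row fct_sumE.
Qed.

Lemma continuous_mulmxr m d (A : 'M[R]_(m, d)) :
  continuous (mulmxr A : 'rV[R]_m -> 'rV[R]_d).
Proof. by move=> x; apply/differentiable_continuous/differentiable_mulmxr. Qed.

Lemma differentiable_rVP d (f : V -> 'rV[R]_d) x :
  differentiable f x <-> forall k, differentiable (fun y => f y 0 k : R) x.
Proof.
split=> [fx k|fx].
  exact: (differentiable_comp fx (differentiable_coord _ _ _)).
rewrite (_ : f = \sum_(k < d) (fun y : V => f y 0 k *: delta_mx 0 k)).
  by apply: differentiable_sum => k; apply/differentiableZl/fx.
by apply/funext => v; rewrite fct_sumE {1}[f v]row_sum_delta.
Qed.

Lemma derive_coord d (f : V -> 'rV[R]_d) x w k : differentiable f x ->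
  ('D_w f x) 0 k = 'D_w (fun y => f y 0 k : R) x.
Proof. by move=> fx; rewrite derive_mx ?mxE//; apply: diff_derivable. Qed.

Lemma differentiable_dot d (f g : V -> 'rV[R]_d) x :
  differentiable f x -> differentiable g x ->
  differentiable (fun y => dot (f y) (g y)) x.
Proof.
move=> /differentiable_rVP fx /differentiable_rVP gx.
rewrite (_ : (fun y => _) = \sum_(k < d) (fun y => f y 0 k * g y 0 k)).
  by apply: differentiable_sum => k; apply: differentiableM.
by apply/funext => v; rewrite fct_sumE.
Qed.

Lemma derive_dot d (f g : V -> 'rV[R]_d) x w :
  differentiable f x -> differentiable g x ->
  'D_w (fun y => dot (f y) (g y)) x = dot ('D_w f x) (g x) + dot (f x) ('D_w g x).
Proof.
move=> fx gx; have /differentiable_rVP fk := fx; have /differentiable_rVP gk := gx.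
rewrite (_ : (fun y => _) = \sum_(k < d) (fun y => f y 0 k * g y 0 k)); last first.
  by apply/funext => v; rewrite fct_sumE.
rewrite derive_sum => [|k]; last by apply: diff_derivable; apply: differentiableM.
rewrite /dot -big_split /=; apply: eq_bigr => k _.
rewrite !derive_coord // deriveM; try exact: diff_derivable.
by rewrite addrC; congr (_ + _); exact: mulrC.
Qed.

Lemma differentiable_scale d (a : V -> R) (f : V -> 'rV[R]_d) x :
  differentiable a x -> differentiable f x ->
  differentiable (fun y => a y *: f y) x.
Proof.
move=> ax /differentiable_rVP fx; apply/differentiable_rVP => k.
rewrite (_ : (fun y => _) = (fun y => a y * f y 0 k)).
  exact: differentiableM.
by apply/funext => y; rewrite mxE.
Qed.

End Rows.

(** A continuous lift of a differentiable map through an immersion is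
    differentiable: with L a left inverse of the differential of G and D the
    differential of the composite, the increment delta of the lift satisfies
    delta = L (D h) + o(h) + o(delta), which forces first delta = O(h) and
    then delta = L (D h) + o(h). *)
Lemma differentiable_lift (V : normedModType R) (m d : nat)
    (G : 'rV[R]_m -> 'rV[R]_d) (c : V -> 'rV[R]_m) x :
  {for x, continuous c} -> differentiable G (c x) -> injective ('d G (c x)) ->
  differentiable (G \o c) x -> differentiable c x.
Proof.
move=> cx dG injG dGc.
pose J := lin1_mx ('d G (c x)).
have JE w : w *m J = 'd G (c x) w by rewrite mul_rV_lin1.
have Jfree : row_free J.
  rewrite -kermx_eq0; apply/eqP/row_matrixP => k; rewrite row0.
  by apply: injG; rewrite -JE linear0; apply/sub_kermxP; rewrite row_sub.
pose L : 'rV[R]_d -> 'rV[R]_m := mulmxr (rowcoord J).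
have LG w : L ('d G (c x) w) = w by rewrite -JE /L /= rowcoordK.
have [K K0 LK] : exists2 k, 0 < k & forall y, `|L y| <= k * `|y|.
  exact: linear_lipschitz (@continuous_mulmxr _ _ _).
have [K' K'0 DK] : exists2 k, 0 < k & forall h, `|'d (G \o c) x h| <= k * `|h|.
  by apply: linear_lipschitz; apply: diff_continuous.
have Dc : continuous ((mulmxr (rowcoord J) : {linear _ -> _}) \o 'd (G \o c) x).
  move=> y; apply: continuous_comp; last exact: continuous_mulmxr.
  exact: diff_continuous.
pose delta h := c (h + x) - c x.
have delta0 : delta @ 0 --> (0 : 'rV[R]_m).
  have -> : (0 : 'rV[R]_m) = c x - c x by rewrite subrr.
  apply: cvgB; last exact: cvg_cst.
  by have := cvg_comp_shift x 0 c; rewrite add0r /= => ->.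
have step (eps : R) : 0 < eps ->
    \forall h \near (0 : V), `|delta h - L ('d (G \o c) x h)| <=
      K * (eps * `|h| + eps * `|delta h|).
  move=> eps0.
  have H1 := diff_near dGc eps0.
  have /delta0 H2 := diff_near dG eps0.
  apply: filterS2 H1 H2 => h /= h1; rewrite /= {1 2}/delta subrK => h2.
  rewrite -{1}(LG (delta h)) -linearB.
  apply: le_trans (LK _) _; rewrite ler_pM2l //.
  rewrite [leRHS]addrC -[leLHS]normrN opprB.
  apply: le_trans (lerD h2 h1); apply: le_trans (ler_normB _ _).
  rewrite le_eqVlt; apply/orP; left; apply/eqP; congr `| _ |.
  rewrite -[c _ - c x]/(delta h).
  set a := G _; set b := G _; set u := 'd _ _ _; set v := 'd _ _ _.
  by move: (a - b) => e; rewrite opprB [RHS]addrC addrA subrK.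
suff [] : differentiable c x /\
  'd c x = (mulmxr (rowcoord J) : {linear _ -> _}) \o 'd (G \o c) x :> (_ -> _) by [].
apply: is_diffP => // eps eps0.
(* For epsilon = 1 / (2 K) half of |delta h| is absorbed by the left-hand
   side of the estimate. *)
have [C C0 dC] : exists2 C : R, 0 < C & \forall h \near (0 : V), `|delta h| <= C * `|h|.
  exists (1 + 2 * K * K'); first by rewrite addr_gt0 // !mulr_gt0.
  have e0 : 0 < (2 * K)^-1 by rewrite invr_gt0 mulr_gt0.
  apply: filterS (step _ e0) => h Hh.
  have Ke : K * ((2 * K)^-1 * `|h| + (2 * K)^-1 * `|delta h|) = (`|h| + `|delta h|) / 2.
    by field; rewrite gt_eqF.
  rewrite Ke in Hh.
  have H1 : `|delta h| <= `|delta h - L ('d (G \o c) x h)| + `|L ('d (G \o c) x h)|.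
    by rewrite -{1}(subrK (L ('d (G \o c) x h)) (delta h)); exact: ler_normD.
  have H2 : `|L ('d (G \o c) x h)| <= K * K' * `|h|.
    by apply: le_trans (LK _) _; rewrite -mulrA ler_pM2l.
  lra.
pose e := eps / (K * (1 + C)).
have e0 : 0 < e by rewrite divr_gt0 // mulr_gt0 // addr_gt0.
apply: filterS2 dC (step _ e0) => h h1 h2.
apply: le_trans h2 _.
have -> : eps * `|h| = K * (e * `|h| + e * (C * `|h|)).
  by rewrite /e; field; rewrite !gt_eqF // addr_gt0.
by rewrite ler_pM2l // lerD2l ler_pM2l.
Qed.

End Calculus.

(** * Smooth scalar and matrix valued functions *)

Section SmoothFunctions.
Variables (R : realType) (m : nat) (U : set 'rV[R]_m).
Hypothesis openU : open U.
Implicit Types f g : 'rV[R]_m -> R.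

(** Scalar counterpart of Ck, for which products and inverses make sense. *)
Fixpoint scalarCk (k : nat) f : Prop :=
  if k is k'.+1 then
    (forall u, U u -> differentiable f u) /\ forall w, scalarCk k' ('D_w f)
  else forall u, U u -> {for u, continuous f}.

Definition smooth_scalar f : Prop := forall k, scalarCk k f.

Lemma near_open (T : Type) (f g : 'rV[R]_m -> T) u :
  (forall v, U v -> f v = g v) -> U u -> \forall v \near u, f v = g v.
Proof. by move=> fg Uu; apply: filterS fg _; apply: open_nbhs_nbhs. Qed.

Lemma eq_scalarCk k f g :
  (forall u, U u -> f u = g u) -> scalarCk k f -> scalarCk k g.
Proof.
elim: k f g => [|k IHk] f g fg /=.
  move=> fc u Uu; rewrite /prop_for /continuous_at -(fg _ Uu).
  by apply: cvg_trans (fc _ Uu); exact: near_eq_cvg (near_open fg Uu).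
move=> [df Df]; split=> [u Uu|w].
  by apply: near_eq_differentiable (df _ Uu); exact: near_open fg Uu.
apply: IHk (Df w) => u Uu; apply: near_eq_derive.
exact: near_open fg Uu.
Qed.

Lemma scalarCk_cst k (a : R) : scalarCk k (cst a).
Proof.
elim: k a => [|k IHk] a /=; first by move=> u _; exact: cst_continuous.
split=> [u _|w]; first exact: differentiable_cst.
by apply: eq_scalarCk (IHk 0) => u _; rewrite derive_cst.
Qed.

Lemma scalarCkW k f : scalarCk k.+1 f -> scalarCk k f.
Proof.
elim: k f => [|k IHk] f [df Df] /=; first by move=> u /df/differentiable_continuous.
by split=> // w; apply: IHk.
Qed.

Lemma scalarCkD k f g : scalarCk k f -> scalarCk k g -> scalarCk k (f + g).
Proof.
elim: k f g => [|k IHk] f g /=.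
  by move=> fc gc u Uu; apply: continuousD; [exact: fc|exact: gc].
move=> [df Df] [dg Dg]; split=> [u Uu|w].
  by apply: differentiableD; [exact: df|exact: dg].
apply: eq_scalarCk (IHk _ _ (Df w) (Dg w)) => u Uu.
by rewrite deriveD //; apply: diff_derivable; [exact: df|exact: dg].
Qed.

Lemma scalarCkM k f g : scalarCk k f -> scalarCk k g -> scalarCk k (f * g).
Proof.
elim: k f g => [|k IHk] f g.
  by move=> fc gc u Uu; apply: continuousM; [exact: fc|exact: gc].
move=> fk gk; have [/scalarCkW fk' /scalarCkW gk'] := (fk, gk).
case: fk gk => [df Df] [dg Dg]; split=> [u Uu|w].
  by apply: differentiableM; [exact: df|exact: dg].
apply: eq_scalarCk (scalarCkD (IHk _ _ fk' (Dg w)) (IHk _ _ gk' (Df w))) => u Uu.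
by rewrite deriveM //; apply: diff_derivable; [exact: df|exact: dg].
Qed.

Lemma scalarCkV k f : (forall u, U u -> f u != 0) ->
  scalarCk k f -> scalarCk k (fun u => (f u)^-1).
Proof.
move=> f0; elim: k => [|k IHk].
  by move=> fc u Uu; exact: cvgV (f0 u Uu) (fc u Uu).
move=> fk; have /IHk fV := scalarCkW fk; case: fk => df Df.
split=> [u Uu|w].
  by apply: differentiableV; [exact: df|exact: f0].
apply: eq_scalarCk (scalarCkM (scalarCk_cst k (-1))
  (scalarCkM (scalarCkM fV fV) (Df w))) => u Uu.
rewrite deriveV; [|exact: f0|by apply: diff_derivable; exact: df].
by rewrite -exprVn expr2 !fctE mulN1r -mulNr.
Qed.

Lemma smooth_scalar_sum (I : Type) (r : seq I) (P : pred I) (F : I -> 'rV[R]_m -> R) :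
  (forall j, smooth_scalar (F j)) -> smooth_scalar (fun u => \sum_(j <- r | P j) F j u).
Proof.
move=> H k; rewrite -fct_sumE; elim/big_rec: _ => [|j g _]; first exact: scalarCk_cst.
by apply: scalarCkD; apply: H.
Qed.

Lemma smooth_scalar_prod (I : Type) (r : seq I) (P : pred I) (F : I -> 'rV[R]_m -> R) :
  (forall j, smooth_scalar (F j)) -> smooth_scalar (fun u => \prod_(j <- r | P j) F j u).
Proof.
move=> H k.
rewrite (_ : (fun u => _) = \prod_(j <- r | P j) F j); last first.
  apply/funext => u; elim/big_ind2 : _ => [||] //.
  by move=> ? ? ? ? -> ->.
elim/big_rec: _ => [|j g _]; first exact: scalarCk_cst.
by apply: scalarCkM; apply: H.
Qed.

Lemma smooth_coord d (f : 'rV[R]_m -> 'rV[R]_d) :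
  smooth U f <-> forall j, smooth_scalar (fun u => f u 0 j).
Proof.
suff H k : Ck k U f <-> forall j, scalarCk k (fun u => f u 0 j).
  by split=> [fs j k|fs k]; [have /H := fs k; exact|apply/H => j; exact: fs].
elim: k f => [|k IHk] f /=.
  split=> [fc j u Uu|fc u Uu].
    exact: (@continuous_comp _ _ _ f (fun N : 'rV[R]_d => N 0 j) u (fc u Uu)
      (@coord_continuous _ _ _ _ _ _)).
  have -> : f = (fun v => \sum_(j < d) f v 0 j *: delta_mx 0 j).
    by apply/funext => v; rewrite {1}[f v]row_sum_delta.
  have H j : (f v 0 j *: (delta_mx 0 j : 'rV[R]_d) @[v --> u]) -->
      f u 0 j *: (delta_mx 0 j : 'rV[R]_d) by exact: cvgZr_tmp (fc j u Uu).
  exact: (cvg_big add_continuous (nbhs_filter u) (fun j _ => H j)).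
split=> [[df Df] j|fs].
  split=> [u Uu|w]; first by have /differentiable_rVP := df u Uu; exact.
  have /IHk/(_ j) := Df w; apply: eq_scalarCk => u Uu.
  by rewrite derive_coord //; apply: df.
have df u : U u -> differentiable f u.
  by move=> Uu; apply/differentiable_rVP => j; case: (fs j) => + _; exact.
split=> // w; apply/IHk => j; case: (fs j) => _ /(_ w); apply: eq_scalarCk => u Uu.
by rewrite derive_coord //; apply: df.
Qed.

Definition smooth_mx p q (A : 'rV[R]_m -> 'M[R]_(p, q)) : Prop :=
  forall j k, smooth_scalar (fun u => A u j k).

Lemma smooth_mx_cst p q (A : 'M[R]_(p, q)) : smooth_mx (cst A).
Proof. by move=> j k l; exact: scalarCk_cst. Qed.

Lemma smooth_mx_tr p q (A : 'rV[R]_m -> 'M[R]_(p, q)) :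
  smooth_mx A -> smooth_mx (fun u => (A u)^T).
Proof. by move=> As j k; under eq_fun do rewrite mxE; exact: As. Qed.

Lemma smooth_mx_mul p q r (A : 'rV[R]_m -> 'M[R]_(p, q)) (B : 'rV[R]_m -> 'M[R]_(q, r)) :
  smooth_mx A -> smooth_mx B -> smooth_mx (fun u => A u *m B u).
Proof.
move=> As Bs j k; under eq_fun do rewrite mxE.
by apply: smooth_scalar_sum => l n; apply: scalarCkM; [exact: As|exact: Bs].
Qed.

Lemma smooth_det p (A : 'rV[R]_m -> 'M[R]_p) :
  smooth_mx A -> smooth_scalar (fun u => \det (A u)).
Proof.
move=> As; apply: smooth_scalar_sum => s n; apply: scalarCkM.
  exact: scalarCk_cst.
by apply: smooth_scalar_prod => j; exact: As.
Qed.

(** Cramer's rule. *)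
Lemma smooth_mx_inv p (A : 'rV[R]_m -> 'M[R]_p) :
  (forall u, U u -> A u \in unitmx) -> smooth_mx A ->
  smooth_mx (fun u => invmx (A u)).
Proof.
move=> Au As j k n.
pose B u := (\det (A u))^-1 * cofactor (A u) k j.
apply: (@eq_scalarCk n B) => [u Uu|].
  by rewrite /B /invmx Au // !mxE.
apply: scalarCkM.
  apply: scalarCkV => [u /Au|]; first by rewrite unitmxE unitfE.
  exact: smooth_det.
apply: scalarCkM; first exact: scalarCk_cst.
apply: smooth_det => a b; under eq_fun do rewrite !mxE; exact: As.
Qed.

Lemma smooth_mx_rowcoord d (J : 'rV[R]_m -> 'M[R]_(m, d)) :
  (forall u, U u -> row_free (J u)) -> smooth_mx J ->
  smooth_mx (fun u => rowcoord (J u)).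
Proof.
move=> Jfree Js; apply: smooth_mx_mul; first exact: smooth_mx_tr.
apply: smooth_mx_inv => [u /Jfree/gram_unit //|].
by apply: smooth_mx_mul => //; exact: smooth_mx_tr.
Qed.

Lemma smooth_differentiable d (f : 'rV[R]_m -> 'rV[R]_d) u :
  smooth U f -> U u -> differentiable f u.
Proof. by move=> /(_ 1%N)[+ _]; exact. Qed.

Lemma smooth_derive d (f : 'rV[R]_m -> 'rV[R]_d) w :
  smooth U f -> smooth U ('D_w f).
Proof. by move=> fs k; case: (fs k.+1) => _; exact. Qed.

Lemma smooth_jacobian d (f : 'rV[R]_m -> 'rV[R]_d) :
  smooth U f -> smooth_mx (fun u => jacobian f u).
Proof.
move=> fs j k n.
have /smooth_coord/(_ k n) := smooth_derive (delta_mx 0 j) fs.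
apply: eq_scalarCk => u Uu.
by rewrite deriveE ?mxE //; exact: smooth_differentiable fs Uu.
Qed.

End SmoothFunctions.

(** * Changes of charts *)

Section Charts.
Variables (R : realType) (m d : nat) (M : topologicalType) (i : M -> 'rV[R]_d).
Implicit Types (U V : set 'rV[R]_m) (phi psi : 'rV[R]_m -> M) (u v w : 'rV[R]_m).

Lemma local_param_open U phi : local_param i U phi -> open U.
Proof. by case. Qed.

Lemma local_param_smooth U phi : local_param i U phi -> smooth U (i \o phi).
Proof. by case=> _ _ _ _ []. Qed.

Lemma local_param_diff U phi u : local_param i U phi -> U u ->
  differentiable (i \o phi) u.
Proof. by move=> /local_param_smooth/smooth_differentiable; apply. Qed.

Lemma local_param_near U phi u (O : set M) : local_param i U phi -> U u ->
  open O -> O (phi u) -> \forall v \near u, U v /\ O (phi v).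
Proof.
move=> [openU _ phic _ _] Uu openO Ophi; apply: filterI.
  exact: open_nbhs_nbhs.
by apply: (phic u Uu); exact: open_nbhs_nbhs.
Qed.

(** The charts are homeomorphisms onto open sets, so a transition map exists
    and is continuous; it is a lift of one immersion through another, whence
    its differentiability. *)
Lemma transition U phi V psi u v :
  local_param i U phi -> local_param i V psi -> U u -> V v -> phi u = psi v ->
  exists tau : 'rV[R]_m -> 'rV[R]_m, [/\ tau v = u, differentiable tau v &
    \forall v' \near v, phi (tau v') = psi v'].
Proof.
move=> chU chV Uu Vv uv.
have [openU inj_phi _ open_phi [_ inj_dphi]] := chU.
pose tau v' := get [set u' | U u' /\ phi u' = psi v'].
have tauE u' v' : U u' -> phi u' = psi v' -> tau v' = u'.
  move=> Uu' e; apply: get_unique => // u'' [Uu'' e'].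
  by apply: inj_phi => //; rewrite e'.
have tauv : tau v = u by exact: tauE.
have near_lift (A : set 'rV[R]_m) : open A -> A u ->
    \forall v' \near v, A (tau v') /\ phi (tau v') = psi v'.
  move=> openA Au.
  have openAU : open (phi @` (A `&` U)) by apply: open_phi; [exact: openI|move=> ? []].
  have := local_param_near chV Vv openAU; rewrite -uv => /(_ (imageP _ (conj Au Uu))).
  by apply: filterS => v' [_ [u' [Au' Uu'] e]]; rewrite (tauE u').
have phi_tau : \forall v' \near v, phi (tau v') = psi v'.
  by apply: filterS (near_lift _ openU Uu) => v' [].
exists tau; split=> //.
apply: (@differentiable_lift _ _ _ _ (i \o phi)); rewrite ?tauv.
- move=> A; rewrite tauv nbhsE => -[A0 [openA0 A0u] A0A].
  by apply: filterS (near_lift _ openA0 A0u) => v' [/A0A].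
- exact: local_param_diff chU Uu.
- exact: inj_dphi Uu.
- apply: near_eq_differentiable (local_param_diff chV Vv).
  by apply: filterS phi_tau => v' /= ->.
Qed.

(** The chain rule through the transition map; the same w' serves the
    inclusion and F. *)
Lemma derive_transition U phi V psi u v w (F : M -> 'rV[R]_d) :
  local_param i U phi -> local_param i V psi -> U u -> V v -> phi u = psi v ->
  differentiable (F \o phi) u ->
  exists w', 'D_w (i \o psi) v = 'D_w' (i \o phi) u /\
             'D_w (F \o psi) v = 'D_w' (F \o phi) u.
Proof.
move=> chU chV Uu Vv uv dF.
have [tau [tauv dtau phi_tau]] := transition chU chV Uu Vv uv; subst u.
have chain (G : M -> 'rV[R]_d) : differentiable (G \o phi) (tau v) ->
    'D_w (G \o psi) v = 'D_('D_w tau v) (G \o phi) (tau v).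
  move=> dG; have -> : 'D_w (G \o psi) v = 'D_w ((G \o phi) \o tau) v.
    by apply: near_eq_derive; apply: filterS phi_tau => v' /= ->.
  rewrite (deriveE _ dG) (deriveE _ dtau) (deriveE _ (differentiable_comp dtau dG)).
  exact: (congr1 (fun h => h w) (diff_comp dtau dG)).
by exists ('D_w tau v); split; apply: chain => //; exact: local_param_diff chU Uu.
Qed.

Lemma TM_chart U phi u X : local_param i U phi -> U u ->
  TM m i (phi u) X <-> exists w, X = 'D_w (i \o phi) u.
Proof.
move=> chU Uu; split=> [[V [psi [v [w [chV Vv vu <-]]]]]|[w ->]]; last first.
  by exists U, phi, u, w.
have [w' [-> _]] := derive_transition w chU chV Uu Vv (esym vu)
  (local_param_diff chU Uu).
by exists w'.
Qed.

Lemma dder_chart U phi u w (F : M -> 'rV[R]_d) : local_param i U phi -> U u ->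
  differentiable (F \o phi) u ->
  dder m i F (phi u) ('D_w (i \o phi) u) = 'D_w (F \o phi) u.
Proof.
move=> chU Uu dF; apply: get_unique; first by exists U, phi, u, w.
move=> Z [V [psi [v [w2 [chV Vv vu e ->]]]]].
have [w' [e' ->]] := derive_transition w2 chU chV Uu Vv (esym vu) dF.
have [_ _ _ _ [_ injd]] := chU.
congr ('D_ _ _ _); apply: (injd u Uu).
have E y := esym (deriveE y (local_param_diff chU Uu)).
exact: etrans (E w') (etrans (esym e') (etrans e (esym (E w)))).
Qed.

Lemma jacobian_free U phi u : local_param i U phi -> U u ->
  row_free (jacobian (i \o phi) u).
Proof.
move=> chU Uu; have [_ _ _ _ [_ injd]] := chU.
rewrite -kermx_eq0; apply/eqP/row_matrixP => k; rewrite row0.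
apply: (injd u Uu); rewrite -mul_rV_lin1 linear0.
by apply/sub_kermxP; rewrite row_sub.
Qed.

Lemma TM_jacobian U phi u X : local_param i U phi -> U u ->
  TM m i (phi u) X <-> exists w, X = w *m jacobian (i \o phi) u.
Proof.
move=> chU Uu; rewrite (TM_chart _ chU Uu).
by split=> -[w ->]; exists w; rewrite deriveEjacobian //; exact: local_param_diff chU Uu.
Qed.

Implicit Types X : 'rV[R]_d.

Definition tangent_proj (q : M) : 'M[R]_d := lin1_mx (Defs.proj (TM m i q)).

Lemma tangent_proj_chart U phi u : local_param i U phi -> U u ->
  (forall y, Defs.proj (TM m i (phi u)) y = y *m tangent_proj (phi u)) /\
  tangent_proj (phi u) = rowcoord (jacobian (i \o phi) u) *m jacobian (i \o phi) u.
Proof.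
move=> chU Uu; set J := jacobian _ _.
have projE y : Defs.proj (TM m i (phi u)) y = y *m (rowcoord J *m J).
  apply: projP => [a b|| s]; rewrite ?(TM_jacobian _ chU Uu).
  - by move=> [w ->] [w' ->]; exists (w - w'); rewrite mulmxBl.
  - by exists (y *m rowcoord J); rewrite mulmxA.
  - by move=> [w ->]; rewrite mulmxA rowproj_dot //; exact: jacobian_free chU Uu.
have E : tangent_proj (phi u) = rowcoord J *m J.
  by apply/row_matrixP => k; rewrite !rowE -projE; apply/rowP => j; rewrite -rowE !mxE.
by split=> // y; rewrite projE E.
Qed.

(** Quantifying over all charts around p, instead of asking for one, saves a
    change of charts at each use. *)
Definition mdiff (F : M -> 'rV[R]_d) (p : M) : Prop :=
  forall U phi u, local_param i U phi -> U u -> phi u = p ->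
    differentiable (F \o phi) u.

Lemma smooth_on_mdiff O F p : smooth_on m i O F -> O p -> mdiff F p.
Proof.
move=> FO Op U phi u chU Uu up.
by apply: (smooth_differentiable (FO U phi chU)); split=> //=; rewrite up.
Qed.

End Charts.

(** * The tangent projection and derivatives along a submanifold *)

Section TangentProjection.
Variables (R : realType) (m d : nat) (M : topologicalType) (i : M -> 'rV[R]_d).
Hypothesis subM : submanifold m i.
Implicit Types (p q : M) (X Y Z v : 'rV[R]_d) (F G : M -> 'rV[R]_d)
  (U : set 'rV[R]_m) (phi : 'rV[R]_m -> M).

Local Notation T := (tangent_proj m i).

Lemma chart_at p : exists (U : set 'rV[R]_m) phi u, [/\ local_param i U phi, U u & phi u = p].
Proof. by case: subM => _ _ _ /(_ p)[U [phi [ch [u Uu up]]]]; exists U, phi, u. Qed.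

Lemma proj_TM p v : Defs.proj (TM m i p) v = v *m T p.
Proof.
by have [U [phi [u [ch Uu <-]]]] := chart_at p; case: (tangent_proj_chart ch Uu).
Qed.

Lemma TM_mx p : exists J : 'M[R]_(m, d), [/\ row_free J, T p = rowcoord J *m J &
  forall X, TM m i p X <-> exists w, X = w *m J].
Proof.
have [U [phi [u [ch Uu <-]]]] := chart_at p; exists (jacobian (i \o phi) u).
split; first exact: jacobian_free ch Uu.
  by case: (tangent_proj_chart ch Uu).
by move=> X; exact: TM_jacobian X ch Uu.
Qed.

Lemma TM_lin p a X Y : TM m i p X -> TM m i p Y -> TM m i p (a *: X + Y).
Proof.
have [J [_ _ TJ]] := TM_mx p; rewrite !TJ => -[w ->] [w' ->].
by exists (a *: w + w'); rewrite mulmxDl scalemxAl.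
Qed.

Lemma TM_proj p v : TM m i p (v *m T p).
Proof.
have [J [_ -> TJ]] := TM_mx p; rewrite TJ.
by exists (v *m rowcoord J); rewrite mulmxA.
Qed.

Lemma TM_sum p (I : Type) (r : seq I) (X : I -> 'rV[R]_d) :
  (forall k, TM m i p (X k)) -> TM m i p (\sum_(k <- r) X k).
Proof.
move=> TX; elim: r => [|k r IHr].
  by rewrite big_nil -(mul0mx _ (T p)); exact: TM_proj.
by rewrite big_cons -(scale1r (X k)); exact: TM_lin.
Qed.

Lemma proj_id p X : TM m i p X -> X *m T p = X.
Proof.
have [J [Jf -> TJ]] := TM_mx p; rewrite TJ => -[w ->].
by rewrite mulmxA rowcoordK.
Qed.

Lemma proj_orth p v X : TM m i p X -> dot (v - v *m T p) X = 0.
Proof.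
have [J [Jf -> TJ]] := TM_mx p; rewrite TJ => -[w ->].
by rewrite mulmxA rowproj_dot.
Qed.

(** In a chart the projection is J^T (J J^T)^-1 J with J the Jacobian matrix of
    the immersion, and products and inverses of smooth matrices are smooth. *)
Lemma smooth_proj U phi : local_param i U phi ->
  smooth_mx U (fun u => T (phi u)).
Proof.
move=> ch; have openU := local_param_open ch.
have Js := smooth_jacobian openU (local_param_smooth ch).
have Jf u : U u -> row_free (jacobian (i \o phi) u) by exact: jacobian_free ch.
move=> j k n; apply: (eq_scalarCk openU _ (smooth_mx_mul openU
  (smooth_mx_rowcoord openU Jf Js) Js j k n)) => u Uu /=.
by case: (tangent_proj_chart ch Uu) => _ ->.
Qed.

Lemma smooth_projv U phi v : local_param i U phi ->
  smooth U (fun u => v *m T (phi u)).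
Proof.
move=> ch; have openU := local_param_open ch; apply/(smooth_coord openU) => j.
exact: (smooth_mx_mul openU (smooth_mx_cst openU v) (smooth_proj ch)).
Qed.

Lemma mdiff_proj v p : mdiff m i (fun q => v *m T q) p.
Proof.
move=> U phi u ch Uu _.
exact: smooth_differentiable (smooth_projv v ch) Uu.
Qed.

(** Projecting a fixed vector to all tangent spaces yields a tangent field that
    is smooth in every chart: extensions exist. *)
Lemma extension_proj p v : extension m i p (v *m T p) (fun q => v *m T q).
Proof.
split=> //; exists setT; split=> //; first exact: openT.
  by move=> U phi ch; rewrite preimage_setT setIT; exact: smooth_projv.
by move=> q _; exact: TM_proj.
Qed.

Lemma extension_mdiff p Y Yf : extension m i p Y Yf -> mdiff m i Yf p.
Proof. by move=> [_ [W [_ Wp sW _]]]; exact: smooth_on_mdiff sW Wp. Qed.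

Lemma mdiff_i p : mdiff m i i p.
Proof. by move=> U phi u ch Uu _; exact: local_param_diff ch Uu. Qed.

Lemma dder_i p X : TM m i p X -> dder m i i p X = X.
Proof.
have [U [phi [u [ch Uu <-]]]] := chart_at p => /(TM_chart _ ch Uu)[w ->].
by rewrite (dder_chart w ch Uu) //; exact: local_param_diff ch Uu.
Qed.

Lemma mdiff_cst v p : mdiff m i (cst v) p.
Proof. by move=> U phi u _ _ _; exact: (differentiable_cst v). Qed.

Lemma dder_cst v p X : TM m i p X -> dder m i (cst v) p X = 0.
Proof.
have [U [phi [u [ch Uu <-]]]] := chart_at p => /(TM_chart _ ch Uu)[w ->].
rewrite (dder_chart w ch Uu); first exact: (derive_cst v).
exact: (differentiable_cst v).
Qed.

Lemma dder_linear F p : mdiff m i F p ->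
  exists A : 'M[R]_d, forall X, TM m i p X -> dder m i F p X = X *m A.
Proof.
have [U [phi [u [ch Uu <-]]]] := chart_at p => dF.
have {}dF := dF _ _ _ ch Uu erefl.
exists (rowcoord (jacobian (i \o phi) u) *m jacobian (F \o phi) u).
move=> X /(TM_chart _ ch Uu)[w ->]; rewrite (dder_chart w ch Uu dF).
rewrite (deriveEjacobian _ dF) (deriveEjacobian _ (local_param_diff ch Uu)).
by rewrite mulmxA rowcoordK //; exact: jacobian_free ch Uu.
Qed.

Lemma near_dder F G p X (O : set M) : open O -> O p ->
  (forall q, O q -> F q = G q) -> TM m i p X -> dder m i F p X = dder m i G p X.
Proof.
move=> openO Op FG TX; congr (get _); apply/funext => Z; apply/propext.
split=> -[U [phi [u [w [ch Uu up e ->]]]]]; exists U, phi, u, w; split=> //;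
  apply: near_eq_derive; (have := local_param_near ch Uu openO; rewrite up => /(_ Op));
  by apply: filterS => v [_ /FG].
Qed.

Lemma dder_sum F p X (n : nat) (a : 'I_n -> R) (Fk : 'I_n -> M -> 'rV[R]_d) :
  (forall q, F q = \sum_k a k *: Fk k q) -> (forall k, mdiff m i (Fk k) p) ->
  TM m i p X -> dder m i F p X = \sum_k a k *: dder m i (Fk k) p X.
Proof.
have [U [phi [u [ch Uu <-]]]] := chart_at p => FE dF /(TM_chart _ ch Uu)[w ->].
have dFk k : differentiable (a k *: (Fk k \o phi)) u.
  by apply: differentiableZ; exact: dF ch Uu erefl.
have -> : F = (\sum_k (a k *: Fk k)) by apply/funext => q; rewrite FE fct_sumE.
have E : (\sum_k (a k *: Fk k)) \o phi = \sum_k (a k *: (Fk k \o phi)).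
  by apply/funext => x; rewrite /= !fct_sumE.
rewrite (dder_chart w ch Uu) E; last exact: differentiable_sum.
rewrite derive_sum => [|k]; last exact: diff_derivable.
apply: eq_bigr => k _; rewrite deriveZ; last by apply: diff_derivable; exact: dF ch Uu erefl.
by rewrite (dder_chart w ch Uu) //; exact: dF ch Uu erefl.
Qed.

Lemma dderD F G p X : mdiff m i F p -> mdiff m i G p -> TM m i p X ->
  dder m i (fun q => F q + G q) p X = dder m i F p X + dder m i G p X.
Proof.
move=> dF dG TX.
rewrite (@dder_sum _ p X 2 (fun=> 1) (fun k => if k == ord0 then F else G)) //.
- by rewrite big_ord_recl big_ord1 !scale1r.
- by move=> q; rewrite big_ord_recl big_ord1 !scale1r.
- by move=> k; case: ifP.
Qed.

Lemma dderZ F p X a : mdiff m i F p -> TM m i p X ->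
  dder m i (fun q => a *: F q) p X = a *: dder m i F p X.
Proof.
move=> dF TX.
have := @dder_sum (fun q => a *: F q) p X 1 (fun=> a) (fun=> F).
rewrite big_ord1; apply=> // q; by rewrite big_ord1.
Qed.

Lemma dder_dot F G p X (O : set M) a : open O -> O p ->
  (forall q, O q -> dot (F q) (G q) = a) ->
  mdiff m i F p -> mdiff m i G p -> TM m i p X ->
  dot (dder m i F p X) (G p) + dot (F p) (dder m i G p X) = 0.
Proof.
move=> openO Op; have [U [phi [u [ch Uu up]]]] := chart_at p; rewrite -up.
move=> FG dF dG /(TM_chart _ ch Uu)[w ->].
have {}dF := dF _ _ _ ch Uu erefl; have {}dG := dG _ _ _ ch Uu erefl.
rewrite (dder_chart w ch Uu dF) (dder_chart w ch Uu dG) -(derive_dot w dF dG).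
rewrite -[RHS](derive_cst a u w); apply: near_eq_derive.
have := local_param_near ch Uu openO; rewrite up => /(_ Op).
by apply: filterS => v [_ /FG].
Qed.

End TangentProjection.

(** * Extensions, frames and traces *)

Section SecondFundamentalForm.
Variables (R : realType) (m d : nat) (M : topologicalType) (i : M -> 'rV[R]_d).
Hypothesis subM : submanifold m i.
Implicit Types (p q : M) (X Y v : 'rV[R]_d) (e : 'I_m -> 'rV[R]_d).

Local Notation T := (tangent_proj m i).
Local Notation D := (dder m i).

(** If W is tangent and W p = 0, then W pairs to zero with every normal field,
    so its derivatives at p pair to zero with every normal vector. Applied to
    the difference of two extensions of the same vector, this shows that their
    derivatives agree modulo TM p. *)
Lemma dder_extension_tangent p X Y Yf Yf' :
  TM m i p X -> extension m i p Y Yf -> extension m i p Y Yf' ->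
  TM m i p (D Yf p X - D Yf' p X).
Proof.
move=> TX Yext Yext'; set Z := _ - _.
pose nu0 := Z - Z *m T p.
pose nu q := nu0 - nu0 *m T q.
have nuT q v : TM m i q v -> dot v (nu q) = 0.
  by move=> Tv; rewrite dotC; exact: proj_orth.
have dnu : mdiff m i nu p.
  move=> U phi u ch Uu up; apply: (@differentiableB _ _ _ (cst nu0)).
    exact: differentiable_cst.
  exact (mdiff_proj nu0 ch Uu up).
have nup : nu p = nu0.
  by rewrite /nu mulmxBl [Z *m _ *m _](proj_id subM (TM_proj subM _ _)) subrr subr0.
have pairing Yg : extension m i p Y Yg ->
    dot (D Yg p X) nu0 = - dot Y (D nu p X).
  move=> ext; have dYg := extension_mdiff ext; case: ext => Yp [W [openW Wp _ TYg]].
  have := dder_dot subM openW Wp (fun q Wq => nuT q _ (TYg q Wq)) dYg dnu TX.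
  by rewrite nup Yp => /eqP; rewrite addr_eq0 => /eqP.
have Znu : dot Z nu0 = 0.
  by rewrite dotBl (pairing _ Yext) (pairing _ Yext') subrr.
suff nu00 : nu0 = 0.
  by have /subr0_eq -> := nu00; exact: TM_proj.
apply: dot_eq0; rewrite {1}/nu0 dotBl Znu (dotC (_ *m _)) /nu0 proj_orth ?subrr //.
exact: TM_proj.
Qed.

Definition tangent_frame p e : Prop :=
  (forall j, TM m i p (e j)) /\ forall j k, dot (e j) (e k) = (j == k)%:R.

Lemma tangent_frame_exists p : exists e, tangent_frame p e.
Proof.
have [J [Jf _ TJ]] := TM_mx subM p; have [E [EE EJ]] := orthonormal_rows Jf.
exists (fun j => row j E); split=> [j|j k].
  have /submxP[w wE] : (row j E <= J)%MS by exact: submx_trans (row_sub j E) EJ.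
  by rewrite TJ; exists w.
have := congr1 (fun A : 'M[R]_m => A j k) EE; rewrite !mxE => <-.
by apply: eq_bigr => l _; rewrite !mxE.
Qed.

Lemma trace_eq p (b : 'rV[R]_d -> 'rV[R]_d -> 'rV[R]_d) t :
  (forall e, tangent_frame p e -> \sum_j b (e j) (e j) = t) -> trace m i p b = t.
Proof.
move=> bt; have [e [Te ee]] := tangent_frame_exists p.
apply: get_unique; first by exists e; split=> //; rewrite bt.
by move=> y [e' [Te' ee' ->]]; exact: bt.
Qed.

(** The m orthonormal rows e_j lie in the m-dimensional row space TM p, hence
    span it. *)
Lemma proj_frame p e v : tangent_frame p e ->
  v *m T p = \sum_j dot v (e j) *: e j.
Proof.
move=> [Te ee]; pose E := \matrix_j e j.
have eE j : row j E = e j by rewrite rowK.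
have EE : E *m E^T = 1%:M.
  apply/matrixP => j k; rewrite [RHS]mxE -ee mxE.
  by apply: eq_bigr => l _; rewrite !mxE.
have [J [Jf _ TJ]] := TM_mx subM p.
have EJ : (E <= J)%MS.
  by apply/row_subP => j; rewrite eE; have /TJ[w ->] := Te j; exact: submxMl.
have JE : (J <= E)%MS.
  rewrite -(geq_leqif (mxrank_leqif_sup EJ)) (eqP Jf).
  by rewrite -[leqLHS](mxrank1 R m) -EE mxrankM_maxl.
have vE : v *m E^T *m E = \sum_j dot v (e j) *: e j.
  rewrite mulmx_sum_row; apply: eq_bigr => j _; rewrite eE; congr (_ *: _).
  by rewrite !mxE; apply: eq_bigr => l _; rewrite !mxE.
rewrite -vE -(proj_TM subM); apply: projP.
- by move=> a b Ta Tb; rewrite -scaleN1r addrC; exact: TM_lin.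
- by rewrite vE; apply: TM_sum => // j; rewrite -[_ *: _]addr0 -(mul0mx _ (T p)); apply: TM_lin => //; exact: TM_proj.
- move=> s /TJ[w ->]; have /submxP[C ->] := JE.
  rewrite mulmxA dotC dot_mulmx mulmxBl.
  by rewrite -!mulmxA EE mulmx1 subrr dot0r.
Qed.

End SecondFundamentalForm.

(** * The second fundamental form and the mean curvature *)

Section MeanCurvature.
Variables (R : realType) (m d : nat) (M : topologicalType) (i : M -> 'rV[R]_d).
Hypothesis subM : submanifold m i.
Implicit Types (p q : M) (X Y Z v : 'rV[R]_d) (e : 'I_m -> 'rV[R]_d).

Local Notation T := (tangent_proj m i).
Local Notation D := (dder m i).

(** Up to the factor m, the component of this vector normal to M is the mean
    curvature vector of M in R^d. *)
Definition frame_derivative (p : M) : 'rV[R]_d :=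
  \sum_(k < d) D (fun q => delta_mx 0 k *m T q) p (delta_mx 0 k *m T p).

(** In a chart, each term is the derivative of a smooth field in a direction
    whose coordinates are the entries of a row of rowcoord J, and these are
    smooth as well. *)
Lemma mdiff_frame_derivative p : mdiff m i frame_derivative p.
Proof.
move=> U phi u ch Uu _; have openU := local_param_open ch.
pose J (v : 'rV[R]_m) := jacobian (i \o phi) v.
pose Tk k (v : 'rV[R]_m) := (delta_mx 0 k : 'rV[R]_d) *m T (phi v).
have sTk k : smooth U (Tk k) by exact: smooth_projv.
have Js : smooth_mx U J := smooth_jacobian openU (local_param_smooth ch).
have Jf (v : 'rV[R]_m) : U v -> row_free (J v) by exact: jacobian_free ch.
have Ws := smooth_mx_rowcoord openU Jf Js.
pose S := \sum_(k < d) \sum_(l < m)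
  (fun v : 'rV[R]_m => rowcoord (J v) k l *: 'D_(delta_mx 0 l) (Tk k) v).
have dS : differentiable S u.
  apply: differentiable_sum => k; apply: differentiable_sum => l.
  apply: differentiable_scale; first by case: (Ws k l 1%N) => + _; exact.
  exact: smooth_differentiable (smooth_derive _ (sTk k)) Uu.
apply: near_eq_differentiable dS.
apply: (near_open openU _ Uu) => v Uv.
rewrite /S fct_sumE /frame_derivative /=; apply: eq_bigr => k _; rewrite fct_sumE.
have dTk := smooth_differentiable (sTk k) Uv.
have -> : (delta_mx 0 k : 'rV[R]_d) *m T (phi v) = 'D_(row k (rowcoord (J v))) (i \o phi) v.
  rewrite (deriveEjacobian _ (local_param_diff ch Uv)).
  by case: (tangent_proj_chart ch Uv) => _ ->; rewrite mulmxA -rowE.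
rewrite (dder_chart _ ch Uv dTk) (deriveE _ dTk) [X in 'd _ _ X]row_sum_delta linear_sum.
by apply: eq_bigr => l _; rewrite linearZ /= -(deriveE _ dTk) [in RHS]mxE.
Qed.

Variables (N : set 'rV[R]_d) (Pi : M -> 'M[R]_d).
Hypothesis PiE : forall p v, Defs.proj (tangent_space N (i p)) v = v *m Pi p.
Hypothesis PiT : forall p X, TM m i p X -> X *m Pi p = X.

Lemma nablaN_E F p X : nablaN m i N F p X = D F p X *m Pi p.
Proof. exact: PiE. Qed.

Lemma nablaM_E F p X : nablaM m i F p X = D F p X *m T p.
Proof. exact: proj_TM. Qed.

(** Any extension of Y computes the second fundamental form. *)
Lemma sff_extension p X Y Yf : TM m i p X -> extension m i p Y Yf ->
  sff m i N p X Y = D Yf p X *m (Pi p - T p).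
Proof.
move=> TX ext; apply: get_unique.
  by exists Yf; rewrite nablaN_E nablaM_E mulmxBr.
move=> Z [Yf' [ext' ->]]; rewrite nablaN_E nablaM_E -mulmxBr.
have TD := dder_extension_tangent subM TX ext' ext.
apply/subr0_eq; rewrite -mulmxBl mulmxBr PiT // (proj_id subM) // subrr.
by [].
Qed.

Lemma sff_proj p X v : TM m i p X ->
  sff m i N p X (v *m T p) = D (fun q => v *m T q) p X *m (Pi p - T p).
Proof. by move=> TX; apply: sff_extension => //; exact: extension_proj. Qed.

Lemma dder_projE p X v : TM m i p X ->
  D (fun q => v *m T q) p X = \sum_k v 0 k *: D (fun q => delta_mx 0 k *m T q) p X.
Proof.
move=> TX; apply: dder_sum => // [q|k]; last exact: mdiff_proj.
by rewrite {1}[v]row_sum_delta mulmx_suml; apply: eq_bigr => k _; rewrite scalemxAl.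
Qed.

(** For an orthonormal frame e of TM p, the sum over j of dder (T e_j) e_j is
    the sum over the standard basis of dder (T delta_k) (T delta_k), as both
    are the contraction of the bilinear form (v, X) |-> dder (T v) X with the
    projection on TM p. *)
Lemma trace_sff p e : tangent_frame i p e ->
  \sum_j sff m i N p (e j) (e j) = frame_derivative p *m (Pi p - T p).
Proof.
move=> fr; have [Te ee] := fr.
have -> : frame_derivative p = \sum_j D (fun q => e j *m T q) p (e j).
  under [RHS]eq_bigr do rewrite dder_projE //.
  rewrite exchange_big /=; apply: eq_bigr => k _.
  have [A DA] := dder_linear subM (mdiff_proj (m := m) (i := i) (delta_mx 0 k) (p := p)).
  rewrite (DA _ (TM_proj subM _ _)) (proj_frame subM _ fr) mulmx_suml.
  apply: eq_bigr => j _; rewrite DA // scalemxAl; congr (_ *: _ *m _).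
  rewrite dotC /dot (bigD1 k) //= mxE !eqxx mulr1 big1 ?addr0 // => l /negPf kl.
  by rewrite mxE kl andbF mulr0.
rewrite mulmx_suml; apply: eq_bigr => j _.
by rewrite -{2}(proj_id subM (Te j)) sff_proj.
Qed.

Lemma mean_curvatureE p :
  mean_curvature m i N p = m%:R^-1 *: (frame_derivative p *m (Pi p - T p)).
Proof.
by rewrite /mean_curvature; congr (_ *: _); apply: trace_eq => // e; exact: trace_sff.
Qed.

End MeanCurvature.

(** * Hyperspheres of the unit sphere *)

Section SmallSpheres.
Variables (R : realType) (d : nat) (c : 'rV[R]_d) (b : R).
Implicit Types z v : 'rV[R]_d.

(** For c a unit vector this is a hypersphere of the unit sphere; c = 0 and
    b = 0 give the unit sphere itself. *)
Definition small_sphere : set 'rV[R]_d := [set z | dot z z = 1 /\ dot z c = b].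

Hypothesis c_unit : c = 0 /\ b = 0 \/ dot c c = 1.
Hypothesis b_lt1 : b ^+ 2 < 1.

Let cc v : dot v c * dot c c = dot v c.
Proof. by case: c_unit => [[-> _]|->]; rewrite ?dot0r ?mul0r ?mulr1. Qed.

Let bc : b * dot c c = b.
Proof. by case: c_unit => [[_ ->]|->]; rewrite ?mul0r ?mulr1. Qed.

Definition radial z := z - b *: c.

Let radial_c z : small_sphere z -> dot (radial z) c = 0.
Proof. by move=> [_ zc]; rewrite /radial dotBl dotZl zc bc subrr. Qed.

Let radial_sqr z : small_sphere z -> dot (radial z) (radial z) = 1 - b ^+ 2.
Proof.
move=> Nz; have [zz zc] := Nz.
by rewrite {2}/radial dotBr dotZr radial_c // mulr0 subr0 dotBl dotZl zz (dotC c) zc expr2.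
Qed.

Lemma is_derive_scalel (f : R -> R) (df t : R) v :
  is_derive t 1 f df -> is_derive t 1 (fun s => f s *: v) (df *: v).
Proof.
move=> [/derivable1_diffP f1 <-].
have dfv := differentiableZl v f1.
by split; [exact: diff_derivable|rewrite deriveE // diffZl // -deriveE].
Qed.

(** The tangent vectors are the velocities of the great circles of the small
    sphere, which have radius sqrt (1 - b^2). *)
Lemma tangent_small_sphere z v : small_sphere z ->
  tangent_space small_sphere z v <-> dot v z = 0 /\ dot v c = 0.
Proof.
move=> Nz; split=> [[g [g0 gN [g1 gv]]]|[vz vc]].
  move/derivable1_diffP: g1 => dg.
  have E (f : R -> 'rV[R]_d) a : differentiable f 0 -> (forall t, dot (g t) (f t) = a) ->
      dot v (f 0) + dot z ('D_1 f 0) = 0.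
    move=> df fa; rewrite -{1}gv -g0 -(derive_dot (1 : R) dg df).
    by rewrite (_ : (fun _ => _) = cst a) ?derive_cst //; apply/funext.
  have := E g 1 dg (fun t => (gN t).1); rewrite gv g0 (dotC z) => vz.
  have := E (cst c) b (differentiable_cst _ _) (fun t => (gN t).2).
  rewrite derive_cst dot0r addr0 => vc; split=> //; lra.
have [->|v0] := eqVneq v 0.
  exists (cst z); split=> //; exact: is_derive_cst.
have yy := radial_sqr Nz; have yc := radial_c Nz.
move yE : (radial z) yy yc => y yy yc.
have vy : dot v y = 0 by rewrite -yE /radial dotBr dotZr vz vc mulr0 subrr.
have vv : 0 < dot v v.
  by rewrite lt_def dot_ge0 andbT; apply: contraNneq v0 => /dot_eq0 ->.
have b1 : 0 < 1 - b ^+ 2 by rewrite subr_gt0.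
pose w := Num.sqrt (dot v v / (1 - b ^+ 2)).
have w2 : w ^+ 2 = dot v v / (1 - b ^+ 2) by rewrite sqr_sqrtr // divr_ge0 ?ltW.
have w0 : w != 0 by rewrite gt_eqF // sqrtr_gt0 divr_gt0.
exists (fun t => b *: c + (cos (w * t) *: y + (w^-1 * sin (w * t)) *: v)); split.
- by rewrite mulr0 cos0 sin0 mulr0 scale0r addr0 scale1r -yE /radial addrC subrK.
- move=> t; split; last first.
    by rewrite !dotDl !dotZl yc vc bc !mulr0 !addr0.
  rewrite !(dotDl, dotDr, dotZl, dotZr) vy yc vc (dotC y v) vy.
  rewrite (dotC c y) yc (dotC c v) vc yy bc.
  have := cos2Dsin2 (w * t).
  have -> : dot v v = w ^+ 2 * (1 - b ^+ 2) by rewrite w2; field; rewrite gt_eqF.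
  set C := cos _; set S := sin _ => CS.
  transitivity (b ^+ 2 + (1 - b ^+ 2) * (C ^+ 2 + S ^+ 2)); last by rewrite CS; ring.
  by field.
- have dw : is_derive (0 : R) 1 (fun t => w * t) w.
    by rewrite -[X in is_derive _ _ _ X]mulr1; exact: is_deriveZ.
  have dcos : is_derive (0 : R) 1 (fun t => cos (w * t)) 0.
    apply: is_derive_eq (is_derive1_comp (is_derive_cos (w * 0)) dw) _.
    by rewrite mulr0 sin0 oppr0 mul0r.
  have dsin : is_derive (0 : R) 1 (fun t => w^-1 * sin (w * t)) 1.
    apply: is_derive_eq (is_deriveZ w^-1 (is_derive1_comp (is_derive_sin (w * 0)) dw)) _.
    by rewrite mulr0 cos0 mul1r; exact: mulVf.
  have dg := is_deriveD (is_derive_cst (b *: c) (0 : R) 1)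
    (is_deriveD (is_derive_scalel y dcos) (is_derive_scalel v dsin)).
  by rewrite scale0r scale1r !add0r in dg.
Qed.


Definition small_sphere_proj z : 'M[R]_d :=
  1%:M - c^T *m c - (1 - b ^+ 2)^-1 *: ((radial z)^T *m radial z).

Lemma small_sphere_projE z v :
  v *m small_sphere_proj z =
  v - dot v c *: c - ((1 - b ^+ 2)^-1 * dot v (radial z)) *: radial z.
Proof.
have E u y : u *m (y^T *m y) = dot u y *: (y : 'rV[R]_d).
  rewrite mulmxA -mul_scalar_mx; congr (_ *m _).
  by apply/matrixP => j k; rewrite !ord1 dotE [RHS]mxE.
rewrite /small_sphere_proj; move: (radial z) => y.
by rewrite !mulmxBr mulmx1 -scalemxAr !E scalerA.
Qed.

Lemma proj_small_sphere z v : small_sphere z ->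
  Defs.proj (tangent_space small_sphere z) v = v *m small_sphere_proj z.
Proof.
move=> Nz; have yy := radial_sqr Nz; have yc := radial_c Nz.
have zE : z = radial z + b *: c by rewrite /radial subrK.
have b1 : 1 - b ^+ 2 != 0 by rewrite subr_eq0 eq_sym lt_eqF.
apply: projP => [s t||s]; rewrite ?tangent_small_sphere //.
- by move=> [s1 s2] [t1 t2]; rewrite !dotBl s1 s2 t1 t2 !subrr.
- have tc : dot (v *m small_sphere_proj z) c = 0.
    by rewrite small_sphere_projE !dotBl !dotZl yc cc subrr mulr0 subr0.
  split=> //; rewrite {2}zE dotDr dotZr tc mulr0 addr0.
  rewrite small_sphere_projE !dotBl !dotZl yy (dotC c) yc mulr0 subr0.
  by field.
- move=> [sz sc]; have sy : dot s (radial z) = 0 by rewrite /radial dotBr dotZr sz sc mulr0 subrr.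
  by rewrite small_sphere_projE !dotBl !dotZl !(dotC _ s) sc sy; ring.
Qed.

Lemma small_sphere_proj_tangent z v : small_sphere z -> dot v z = 0 -> dot v c = 0 ->
  v *m small_sphere_proj z = v.
Proof.
move=> Nz vz vc; rewrite small_sphere_projE vc /radial dotBr dotZr vz vc.
by rewrite !mulr0 subrr mulr0 !scale0r !subr0.
Qed.

Lemma small_sphere_proj_center z : small_sphere z -> c *m small_sphere_proj z = 0.
Proof.
move=> Nz; rewrite small_sphere_projE (dotC c (radial z)) radial_c // mulr0 scale0r subr0.
by case: c_unit => [[-> _]|->]; rewrite ?scaler0 ?scale1r subrr.
Qed.

Lemma small_sphere_proj_point z : small_sphere z -> z *m small_sphere_proj z = 0.
Proof.
move=> Nz; have b1 : 1 - b ^+ 2 != 0 by rewrite subr_eq0 eq_sym lt_eqF.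
have {1}-> : z = radial z + b *: c by rewrite /radial subrK.
rewrite mulmxDl -scalemxAl small_sphere_proj_center // scaler0 addr0.
rewrite small_sphere_projE radial_c // scale0r subr0 radial_sqr // mulVf //.
by rewrite scale1r subrr.
Qed.

End SmallSpheres.

Section InSmallSphere.
Variables (R : realType) (m d : nat) (M : topologicalType) (i : M -> 'rV[R]_d).
Hypothesis subM : submanifold m i.
Variables (c : 'rV[R]_d) (b : R).
Hypothesis c_unit : c = 0 /\ b = 0 \/ dot c c = 1.
Hypothesis iN : forall p, small_sphere c b (i p).

Lemma TM_small_sphere p X : TM m i p X -> dot X (i p) = 0 /\ dot X c = 0.
Proof.
move=> TX.
have dip := dder_i subM TX; have di := mdiff_i (m := m) (i := i) (p := p).
have dc := mdiff_cst (m := m) (i := i) c (p := p); have dcp := dder_cst subM c TX.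
have := dder_dot subM openT (I : setT p) (fun q _ => (iN q).1) di di TX.
have := dder_dot subM openT (I : setT p) (fun q _ => (iN q).2) di dc TX.
rewrite dip dcp dot0r addr0 (dotC (i p)) => -> ?; split=> //; lra.
Qed.

Lemma small_sphere_proj_TM p X : b ^+ 2 < 1 -> TM m i p X ->
  X *m small_sphere_proj c b (i p) = X.
Proof.
by move=> b1 /TM_small_sphere[Xi Xc]; exact: small_sphere_proj_tangent.
Qed.

End InSmallSphere.

(** * Pseudo-umbilical submanifolds with parallel mean curvature *)

Section ParallelPseudoUmbilical.
Variables (R : realType) (m d : nat) (M : topologicalType) (i : M -> 'rV[R]_d).
Hypothesis subM : submanifold m i.
Implicit Types (p q : M) (X Y Z v : 'rV[R]_d).

Local Notation S := (small_sphere (0 : 'rV[R]_d) 0).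
Local Notation T := (tangent_proj m i).
Local Notation D := (dder m i).
Local Notation H := (mean_curvature m i S).

Hypothesis iS : forall p, S (i p).

Let Pi p := small_sphere_proj 0 0 (i p).

Let center0 : (0 : 'rV[R]_d) = 0 /\ (0 : R) = 0 \/ dot (0 : 'rV[R]_d) 0 = 1.
Proof. by left. Qed.

Let lt01 : (0 : R) ^+ 2 < 1.
Proof. by rewrite expr0n ltr01. Qed.

Let PiE p v : Defs.proj (tangent_space S (i p)) v = v *m Pi p.
Proof. exact (proj_small_sphere center0 lt01 v (iS p)). Qed.

Let PiT p X : TM m i p X -> X *m Pi p = X.
Proof. exact (small_sphere_proj_TM subM iS lt01 (X := X)). Qed.

Let Pi_point p v : v *m Pi p = v - dot v (i p) *: i p.
Proof.
rewrite small_sphere_projE dot0r scale0r subr0 /radial scaler0 subr0.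
by rewrite expr0n subr0 invr1 mul1r.
Qed.

Let TM_point p X : TM m i p X -> dot X (i p) = 0.
Proof. by move=> /(TM_small_sphere subM iS)[]. Qed.

Lemma mean_curvature_point p : dot (H p) (i p) = 0.
Proof.
rewrite (mean_curvatureE subM PiE PiT) dotZl mulmxBr dotBl.
rewrite (TM_point (TM_proj subM _ _)) Pi_point dotBl dotZl (iS p).1.
by rewrite mulr1 subrr subr0 mulr0.
Qed.

Lemma mean_curvature_normal p X : TM m i p X -> dot (H p) X = 0.
Proof.
move=> TX; rewrite (mean_curvatureE subM PiE PiT) dotZl mulmxBr Pi_point.
rewrite addrAC dotBl dotZl (proj_orth subM) // (dotC (i p)) (TM_point TX).
by rewrite mulr0 subr0 mulr0.
Qed.

Lemma mdiff_mean_curvature p : mdiff m i H p.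
Proof.
move=> U phi u ch Uu up.
have dG := mdiff_frame_derivative ch Uu up.
have di := local_param_diff ch Uu.
pose G := frame_derivative m i.
rewrite (_ : H \o phi = m%:R^-1 *: (G \o phi
    - (fun v : 'rV[R]_m => dot (G (phi v)) (i (phi v)) *: i (phi v))
    - \sum_k (fun v : 'rV[R]_m => G (phi v) 0 k *: (delta_mx 0 k *m T (phi v))))); last first.
  apply/funext => v.
  rewrite /= (mean_curvatureE subM PiE PiT) mulmxBr Pi_point /=; congr (_ *: (_ - _)).
  rewrite fct_sumE {1}[frame_derivative _ _ _]row_sum_delta mulmx_suml.
  by apply: eq_bigr => k _; rewrite scalemxAl.
apply: differentiableZ; apply: differentiableB.
  apply: differentiableB; first exact dG.
  exact (differentiable_scale (differentiable_dot dG di) di).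
apply: differentiable_sum => k.
have /differentiable_rVP dGk := dG.
exact (differentiable_scale (dGk k) (mdiff_proj (delta_mx 0 k) ch Uu up)).
Qed.

Hypothesis pu : pseudo_umbilical m i S.
Hypothesis par : parallel_mean_curvature m i S.

(** The derivative of H is tangent to M: its component along the position
    vector vanishes because H is tangent to the sphere, the normal one because
    H is parallel. Its tangent component is minus the Weingarten operator of
    H, obtained by differentiating the orthogonality of H to tangent fields. *)
Lemma dder_mean_curvature p X : TM m i p X ->
  D H p X = - enorm (H p) ^+ 2 *: X.
Proof.
move=> TX; have dH := mdiff_mean_curvature (p := p).
have Dpoint : dot (D H p X) (i p) = 0.
  have := dder_dot subM openT (I : setT p) (fun q _ => mean_curvature_point q) dH
    (mdiff_i (p := p)) TX.
  by rewrite (dder_i subM TX) mean_curvature_normal // addr0.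
have DPi : D H p X *m Pi p = D H p X by rewrite Pi_point Dpoint scale0r subr0.
have DT : D H p X = D H p X *m T p.
  apply/subr0_eq; have := par TX.
  by rewrite /nabla_normal (nablaN_E m PiE) DPi (proj_TM subM).
have sffH Y : TM m i p Y -> dot (sff m i S p X Y) (H p) = dot (- D H p X) Y.
  move=> TY; rewrite -(proj_id subM TY) (sff_proj subM PiE PiT) //.
  have HY q : dot (H q) (Y *m T q) = 0 by exact: mean_curvature_normal (TM_proj subM _ _).
  have := dder_dot subM openT (I : setT p) (fun q _ => HY q) dH (mdiff_proj Y (p := p)) TX.
  move: (D (fun q => Y *m T q) p X) => DY /eqP.
  rewrite addr_eq0 dotNl (proj_id subM TY) => /eqP ->; rewrite opprK.
  rewrite mulmxBr dotBl Pi_point dotBl dotZl (dotC (i p)) mean_curvature_point.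
  by rewrite (dotC (DY *m _)) (mean_curvature_normal (TM_proj subM _ _)) mulr0 !subr0 dotC.
(* The vectors representing the form Y |-> <B(X, Y), H> on TM p, among which
   the Weingarten operator is chosen, include - D_X H: there is one. *)
have [TW WE] : TM m i p (weingarten m i S p (H p) X) /\ forall Y, TM m i p Y ->
    dot (weingarten m i S p (H p) X) Y = dot (sff m i S p X Y) (H p).
  apply: (getPex (P := [set Z | TM m i p Z /\ forall Y, TM m i p Y ->
    dot Z Y = dot (sff m i S p X Y) (H p)])).
  exists (- D H p X); split=> [|Y TY]; last by rewrite sffH.
  by rewrite DT -mulNmx; exact: TM_proj.
have W : weingarten m i S p (H p) X = - D H p X.
  apply/subr0_eq/dot_eq0.
  have TD : TM m i p (weingarten m i S p (H p) X - - D H p X).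
    by rewrite opprK DT addrC -(scale1r (_ *m _)); apply: TM_lin => //; exact: TM_proj.
  by rewrite dotBl WE // sffH // subrr.
by have := pu TX; rewrite W scaleNr => <-; rewrite opprK.
Qed.

Variable h : R.
Hypothesis h_neq0 : h != 0.
Hypothesis normH : forall p, enorm (H p) = h.

Lemma dimension_neq0 p : m%:R != 0 :> R.
Proof.
apply: contraNneq h_neq0 => m0.
rewrite -(normH p) (mean_curvatureE subM PiE PiT) m0 invr0 scale0r.
by rewrite /enorm dot0l sqrtr0.
Qed.

(** Since D H = - h^2 Id, the connection on the pull-back bundle acts on
    nabla H as on - h^2 times a tangent field, which leaves - h^2 times the
    second fundamental form. *)
Lemma hessian_mean_curvature p X v : TM m i p X ->
  hessian m i S H p X (v *m T p) = - h ^+ 2 *: sff m i S p X (v *m T p).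
Proof.
move=> TX.
have nablaH q V : TM m i q V -> nablaN m i S H q V = - h ^+ 2 *: V.
  move=> TV; rewrite (nablaN_E m PiE) dder_mean_curvature // normH.
  by rewrite -scalemxAl PiT.
have E Yf : extension m i p (v *m T p) Yf ->
    nablaN m i S (fun q => nablaN m i S H q (Yf q)) p X - nablaN m i S H p (nablaM m i Yf p X)
    = - h ^+ 2 *: sff m i S p X (v *m T p).
  move=> ext; rewrite (sff_extension subM PiE PiT TX ext) nablaH; last first.
    by rewrite (nablaM_E subM); exact: TM_proj.
  have dYf := extension_mdiff ext; case: ext => _ [W [openW Wp _ TYf]].
  rewrite (nablaN_E m PiE) (near_dder openW Wp (G := fun q => - h ^+ 2 *: Yf q)) //.
    by rewrite (dderZ subM) // (nablaM_E subM) [in RHS]mulmxBr -scalemxAl scalerBr.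
  by move=> q Wq; exact: nablaH (TYf q Wq).
apply: get_unique.
  by exists (fun q => v *m T q); split; [exact: extension_proj|rewrite E //; exact: extension_proj].
by move=> Z [Yf [ext ->]]; exact: E.
Qed.

Lemma rough_laplacian_mean_curvature p :
  rough_laplacian m i S H p = (m%:R * h ^+ 2) *: H p.
Proof.
rewrite /rough_laplacian (trace_eq subM (t := - (m%:R * h ^+ 2) *: H p)) ?scaleNr ?opprK //.
move=> e fr; have [Te _] := fr.
have -> : \sum_j hessian m i S H p (e j) (e j) = - h ^+ 2 *: \sum_j sff m i S p (e j) (e j).
  rewrite scaler_sumr; apply: eq_bigr => j _.
  by rewrite -{2 4}(proj_id subM (Te j)) hessian_mean_curvature.
rewrite (trace_sff subM PiE PiT fr) (mean_curvatureE subM PiE PiT) scalerA.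
by rewrite -scaleNr; congr (_ *: _); have m0 := dimension_neq0 p; field.
Qed.

End ParallelPseudoUmbilical.

(** * Constancy of fields, and the hypersphere containing the submanifold *)

Section LocallyConstant.
Variables (R : realType) (m d : nat).

(** The mean value theorem on the segments issued from u, coordinate by
    coordinate. *)
Lemma locally_constant (U : set 'rV[R]_m) (f : 'rV[R]_m -> 'rV[R]_d) u :
  open U -> U u -> (forall v, U v -> differentiable f v) ->
  (forall v w, U v -> 'D_w f v = 0) -> \forall v \near u, f v = f u.
Proof.
move=> openU Uu df f0.
have /nbhs_ballP[r /= r0 rU] : nbhs u U by exact: open_nbhs_nbhs.
apply/nbhs_ballP; exists r => // v uv; apply/rowP => k.
pose g (t : R) := u + t *: (v - u).
have Ug (t : R) : 0 <= t -> t <= 1 -> U (g t).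
  move=> t0 t1; apply: rU; rewrite -ball_normE /= /g opprD addNKr normrN normrZ.
  rewrite (ger0_norm t0); apply: le_lt_trans (_ : `|v - u| < r).
    by rewrite ler_piMl.
  by move: uv; rewrite -ball_normE /= distrC.
have dg (t : R) : differentiable g t.
  apply: differentiableD; first exact: differentiable_cst.
  by apply: differentiableZl; exact: (@ex_diff _ _ _ _ _ _ _ (is_diff_id _)).
have D0 (t : R) : 0 <= t -> t <= 1 -> is_derive t 1 (fun s : R => f (g s) 0 k) 0.
  move=> t0 t1; have dfg : differentiable (f \o g) t.
    by apply: differentiable_comp => //; exact: df (Ug _ t0 t1).
  have /differentiable_rVP/(_ k) dk := dfg.
  split; first exact: diff_derivable.
  rewrite -(derive_coord _ _ dfg) (deriveE _ dfg).
  have -> := diff_comp (dg t) (df _ (Ug _ t0 t1)).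
  by rewrite /= -(deriveE _ (df _ (Ug _ t0 t1))) f0 ?mxE //; exact: Ug.
have [| |t _] := @MVT_segment R (fun s => f (g s) 0 k) (fun=> 0) 0 1 ler01.
- by move=> t; rewrite in_itv /= => /andP[t0 t1]; apply: D0; exact: ltW.
- apply: derivable_within_continuous => t; rewrite in_itv /= => /andP[t0 t1].
  by have [] := D0 t t0 t1.
- rewrite mul0r /g scale0r addr0 scale1r [u + (v - u)]addrC subrK => /eqP.
  by rewrite subr_eq0 => /eqP.
Qed.

Variables (M : topologicalType) (i : M -> 'rV[R]_d).
Hypothesis subM : submanifold m i.

Lemma connected_constant (F : M -> 'rV[R]_d) :
  (forall p, mdiff m i F p) -> (forall p X, TM m i p X -> dder m i F p X = 0) ->
  connected [set: M] -> forall p q, F p = F q.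
Proof.
move=> dF F0 connM p q.
have loc x : exists W : set M, [/\ open W, W x & forall y, W y -> F y = F x].
  have [U [phi [u [ch Uu <-]]]] := chart_at subM x; have openU := local_param_open ch.
  have dFphi v : U v -> differentiable (F \o phi) v by move=> Uv; exact (dF _ _ _ _ ch Uv erefl).
  have Fcst : \forall v \near u, U v /\ (F \o phi) v = (F \o phi) u.
    apply: filterI; first exact: open_nbhs_nbhs.
    apply: (locally_constant openU Uu dFphi) => v w Uv.
    rewrite -(dder_chart w ch Uv (dFphi _ Uv)); apply: F0.
    by apply/(TM_chart _ ch Uv); exists w.
  have : nbhs u [set v | U v /\ (F \o phi) v = (F \o phi) u] by exact: Fcst.
  rewrite nbhsE => -[A [openA Au] AU].
  case: (ch) => _ _ _ open_phi _; exists (phi @` A); split.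
  - by apply: open_phi => // v /AU[].
  - by exists u.
  - by move=> _ [v /AU[_ e] <-].
have openF (P : set 'rV[R]_d) : open (F @^-1` P).
  rewrite openE => x Px; have [W [openW Wx WF]] := loc x.
  by rewrite /interior nbhsE; exists W => // y /WF; rewrite /preimage /= => ->.
have : F @^-1` [set F p] = [set: M].
  apply: connM; first by exists p.
    by exists (F @^-1` [set F p]); rewrite ?setTI.
  exists (F @^-1` [set F p]); rewrite ?setTI // -[X in closed X]setCK.
  by apply: open_closedC; rewrite preimage_setC.
by move=> /seteqP[_ /(_ q I)] ->.
Qed.

End LocallyConstant.

Section Hyperspheres.
Variables (R : realType) (n : nat).

Lemma sphereE : sphere (n := n) = small_sphere (0 : 'rV[R]_(n + 1)) 0.
Proof.
apply/seteqP; split=> x; rewrite /small_sphere /sphere /= dot0r.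
  by move=> /(enormP _ ler01) ->; rewrite expr1n.
by move=> [xx _]; apply/(enormP _ ler01); rewrite xx expr1n.
Qed.

Lemma dot_row_mx k l (x x' : 'rV[R]_k) (y y' : 'rV[R]_l) :
  dot (row_mx x y) (row_mx x' y') = dot x x' + dot y y'.
Proof. by rewrite !dotE tr_row_mx mul_row_col mxE. Qed.

(** The model hypersphere is the one around the last basis vector e, and a
    reflection carries e to c. *)
Lemma hypersphere_rotate (a b : R) (c : 'rV[R]_(n + 1)) :
  0 <= a -> 0 <= b -> a ^+ 2 + b ^+ 2 = 1 -> dot c c = 1 ->
  exists Q : 'M[R]_(n + 1), orthogonal_mx Q /\
    [set y *m Q | y in hypersphere (n := n) a] = small_sphere c b.
Proof.
move=> a0 b0 ab cc; pose e : 'rV[R]_(n + 1) := row_mx 0 1%:M.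
have bE : Num.sqrt (1 - a ^+ 2) = b by rewrite -ab addrC addKr sqrtr_sqr ger0_norm.
have dot1 (y : 'rV[R]_1) : dot y 1%:M = y 0 0 by rewrite /dot big_ord1 mxE mulr1.
have ee : dot e e = 1 by rewrite dot_row_mx dot0l add0r dot1 mxE.
have [Q [QQ Qsym eQ]] := reflection_exists ee cc; rewrite Qsym in QQ.
have dotQ u v : dot (u *m Q) (v *m Q) = dot u v.
  by rewrite dot_mulmx Qsym -mulmxA QQ mulmx1.
exists Q; split; first by rewrite /orthogonal_mx Qsym.
rewrite /hypersphere bE; apply/seteqP; split=> [_ [_ [x xa <-] <-]|z [zz zc]].
  move: xa => /= /(enormP _ a0) xa; split.
    rewrite dotQ dot_row_mx xa; apply: etrans ab.
    by rewrite /dot big_ord1 !mxE mulr1n expr2.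
  by rewrite -eQ dotQ dot_row_mx dot0r add0r dot1 mxE.
have zQ : z = z *m Q *m Q by rewrite -mulmxA QQ mulmx1.
have ye : rsubmx (z *m Q) = b%:M.
  apply/matrixP => j k; rewrite !ord1 -dot1 [RHS]mxE mulr1n -zc -eQ [in RHS]zQ dotQ.
  by rewrite -[z *m Q in RHS]hsubmxK dot_row_mx dot0r add0r.
exists (z *m Q); last exact: esym.
exists (lsubmx (z *m Q)); last by rewrite -ye hsubmxK.
apply/(enormP _ a0); have := dotQ z z; rewrite -{1 2}[z *m Q]hsubmxK dot_row_mx ye zz.
rewrite {2}/dot big_ord1 !mxE mulr1n -expr2 -{1}ab; lra.
Qed.

End Hyperspheres.

Section InHypersphere.
Variables (R : realType) (m d : nat) (M : topologicalType) (i : M -> 'rV[R]_d).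
Hypothesis subM : submanifold m i.
Hypothesis iS : forall p, small_sphere (0 : 'rV[R]_d) 0 (i p).

(** The tangent spaces of the hypersphere are contained in those of the unit
    sphere, so its Levi-Civita connection, and with it the second fundamental
    form, is obtained by one more projection. *)
Lemma mean_curvature_small_sphere (c : 'rV[R]_d) (b : R) p :
  dot c c = 1 -> b ^+ 2 < 1 -> (forall q, small_sphere c b (i q)) ->
  mean_curvature m i (small_sphere c b) p =
  mean_curvature m i (small_sphere 0 0) p *m small_sphere_proj c b (i p).
Proof.
move=> cc b1 iN.
have H0 : (0 : 'rV[R]_d) = 0 /\ (0 : R) = 0 \/ dot (0 : 'rV[R]_d) 0 = 1 by left.
have Hc : c = 0 /\ b = 0 \/ dot c c = 1 by right.
have l1 : (0 : R) ^+ 2 < 1 by rewrite expr0n ltr01.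
have P0 q v := proj_small_sphere H0 l1 v (iS q).
have Pc q v := proj_small_sphere Hc b1 v (iN q).
have T0 q X := small_sphere_proj_TM (p := q) subM iS l1 (X := X).
have Tc q X := small_sphere_proj_TM (p := q) subM iN b1 (X := X).
rewrite (mean_curvatureE subM P0 T0) (mean_curvatureE subM Pc Tc) -scalemxAl.
congr (_ *: _); rewrite (mulmxBr _ (small_sphere_proj c b _)).
rewrite (mulmxBr _ (small_sphere_proj 0 0 _)) mulmxBl (Tc _ _ (TM_proj subM _ _)).
congr (_ - _); rewrite (small_sphere_projE 0 0) dot0r scale0r subr0 /radial.
rewrite scaler0 subr0 mulmxBl -scalemxAl (small_sphere_proj_point Hc b1 (iN p)).
by rewrite scaler0 subr0.
Qed.

End InHypersphere.

(** * The theorem *)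

Theorem mainTheorem3 (R : realType) (m n : nat) (M : topologicalType)
    (i : M -> 'rV[R]_(n + 1)) (h : R)
    (M_neq0 : [set: M] !=set0)
    (subM : submanifold m i)
    (sphM : forall p : M, @sphere R n (i p))
    (puM : pseudo_umbilical m i (@sphere R n))
    (parM : parallel_mean_curvature m i (@sphere R n))
    (h_neq0 : h != 0)
    (normH : forall p : M, enorm (mean_curvature m i (@sphere R n) p) = h) :
  properly_biharmonic_of_index m i (@sphere R n) (m%:R * (1 - h ^+ 2)) /\
  (connected [set: M] ->
   exists Q : 'M[R]_(n + 1), orthogonal_mx Q /\
     harmonic_in m i
       [set y *m Q | y in hypersphere (n := n) (1 / Num.sqrt (1 + h ^+ 2))]).
Proof.
rewrite sphereE in sphM puM parM normH *.
set S := small_sphere 0 0 in sphM puM parM normH *.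
pose H := mean_curvature m i S.
(* h is the norm of a vector at some point of M, hence nonnegative. *)
have h_gt0 : 0 < h.
  by case: M_neq0 => p _; rewrite lt_def h_neq0 -(normH p) sqrtr_ge0.
split.
  split=> [p|[_ H0]].
    rewrite (rough_laplacian_mean_curvature subM sphM puM parM h_neq0 normH).
    by rewrite -scalerBl -scalerDl (_ : _ + _ = 0) ?scale0r //; ring.
  case: M_neq0 => p _; move: h_neq0; rewrite -(normH p) H0.
  by rewrite /enorm dot0l sqrtr0 eqxx.
move=> connM; case: M_neq0 => p0 _.
have Hi p : dot (H p) (i p) = 0 by exact: mean_curvature_point subM sphM p.
pose C p := H p + h ^+ 2 *: i p.
have CC p : dot (C p) (C p) = h ^+ 2 * (1 + h ^+ 2).
  have := enorm_sqr (H p); rewrite normH /C; move: (H p) (Hi p) => v vi HH.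
  rewrite !(dotDl, dotDr, dotZl, dotZr) (dotC (i p) v) vi -HH (sphM p).1.
  by ring.
have Ci p : dot (i p) (C p) = h ^+ 2.
  by rewrite dotDr dotZr dotC Hi (sphM p).1; ring.
have Ccst p : C p = C p0.
  apply: (connected_constant subM) => // q.
    move=> U phi u ch Uu uq; apply: differentiableD.
      exact (mdiff_mean_curvature subM sphM ch Uu uq).
    by apply: differentiableZ; exact: local_param_diff ch Uu.
  move=> X TX; have dH := mdiff_mean_curvature subM sphM (p := q).
  have dhi : mdiff m i (fun x => h ^+ 2 *: i x) q.
    by move=> U phi u ch Uu uq; apply: differentiableZ; exact: local_param_diff ch Uu.
  rewrite /C (dderD subM dH dhi TX) (dderZ subM _ (mdiff_i (p := q)) TX) (dder_i subM TX).
  rewrite (dder_mean_curvature subM sphM puM parM TX) normH.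
  by rewrite scaleNr addNr.
(* |C| = h s, so c is the unit vector along C, and b is the constant value of
   <i, c> = h^2 / (h s). *)
pose s := Num.sqrt (1 + h ^+ 2).
have s2 : s ^+ 2 = 1 + h ^+ 2 by rewrite sqr_sqrtr // addr_ge0 // sqr_ge0.
have s_gt0 : 0 < s by rewrite sqrtr_gt0 ltr_pwDl // sqr_ge0.
pose c := (h * s)^-1 *: C p0; pose b := h / s.
have hs0 : h * s != 0 by rewrite mulf_neq0 // gt_eqF.
have cc : dot c c = 1.
  by rewrite /c dotZl dotZr CC -s2; field; rewrite h_neq0 gt_eqF.
have iN p : small_sphere c b (i p).
  split; first exact: (sphM p).1.
  by rewrite /c dotZr -(Ccst p) Ci /b; field; rewrite h_neq0 gt_eqF.
have b_lt1 : b ^+ 2 < 1.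
  by rewrite expr_div_n s2 ltr_pdivrMr ?mul1r ?ltrDr // -s2 exprn_gt0.
have ab : (1 / s) ^+ 2 + b ^+ 2 = 1.
  by rewrite !expr_div_n expr1n -mulrDl s2 mulfV // -s2 expf_neq0 // gt_eqF.
have a_ge0 : 0 <= 1 / s by rewrite divr_ge0 // ltW.
have b_ge0 : 0 <= b by rewrite divr_ge0 // ltW.
have [Q [QQ NE]] := hypersphere_rotate a_ge0 b_ge0 ab cc.
exists Q; split=> //; rewrite NE; split=> // p.
have c_unit : c = 0 /\ b = 0 \/ dot c c = 1 by right.
rewrite (mean_curvature_small_sphere subM sphM p cc b_lt1 iN) -/S -/(H p).
have -> : H p = (h * s) *: c - h ^+ 2 *: i p.
  by rewrite /c scalerA mulfV // scale1r -(Ccst p) addrK.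
(* The value of c has to be hidden: its scalar factor would be moved too. *)
clearbody c; rewrite mulmxBl -!scalemxAl (small_sphere_proj_center c_unit (iN p)).
by rewrite (small_sphere_proj_point c_unit b_lt1 (iN p)) !scaler0 subrr.
Qed.
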